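(* Let $n > 1$ and let $M$ denote the Hardy-Littlewood maximal operator on $\mathbb{R}^n$, either the centred or the non-centred one (the result holds for each of the two). Let $u \in L^{1}_{loc}(\mathbb{R}^{n})$ be a non-negative function such that $Mu \in L^{1}_{loc}(\mathbb{R}^{n})$. Let $\alpha$ and $\mu$ be as in one of the following two alternatives: either (a) $\alpha = 0$ and $\mu$ equals the Lebesgue measure on $\mathbb{R}^n$, or (b) $\alpha \in (0,1]$ and $\mu$ is a locally finite positive Borel measure on $\mathbb{R}^n$. Suppose that there is a constant $C > 0$ such that for all cubes $Q \subset \mathbb{R}^n$ $$\frac{1}{|Q|}\int_{Q} |u - u_{Q}| \, dx \leq C \operatorname{diam}(Q)^{\alpha} \, \frac{\mu(Q)}{|Q|}.$$ Then there is a constant $C'$ comparable to $C$, that is, $C' \le c\, C$ with $c$ depending only on $n$ and $\alpha$, such that for all cubes $Q \subset \mathbb{R}^n$ $$\frac{1}{|Q|}\int_{Q} |Mu - (Mu)_{Q}| \, dx \leq C' \operatorname{diam}(Q)^{\alpha} \inf_{z \in Q} M\mu(z).$$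
   Context: Cubes are open cubes in $\mathbb{R}^n$ with sides parallel to the coordinate axes. $|E|$ is the Lebesgue measure of $E$, $\operatorname{diam}(E)$ is its diameter, and $f_Q = \frac{1}{|Q|}\int_Q f\,dx$. For $f \in L^1_{loc}(\mathbb{R}^n)$, the non-centred Hardy-Littlewood maximal function is $Mf(x) = \sup_{Q \ni x} \frac{1}{|Q|}\int_Q |f|\,dy$, the supremum being over all cubes $Q$ containing $x$; the centred maximal function is defined by the same formula with the supremum restricted to cubes centred at $x$. For a positive Borel measure $\mu$, $M\mu(x) = \sup_{Q} \frac{\mu(Q)}{|Q|}$ with the supremum over the same family of cubes ($M\mu$ may take the value $+\infty$, in which case the inequality is understood in $[0,\infty]$). The centred and non-centred versions are pointwise comparable up to dimensional constants, so either may be used on the right-hand side. *)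

(* Defs.v *)
From HB Require Import structures.
From mathcomp Require Import all_boot all_order all_algebra.
From mathcomp Require Import lra.
From mathcomp Require Import all_classical all_reals all_analysis.

Set Implicit Arguments.
Unset Strict Implicit.
Unset Printing Implicit Defensive.

Import Order.TTheory GRing.Theory Num.Theory.
Import numFieldNormedType.Exports.

Local Open Scope classical_set_scope.
Local Open Scope ring_scope.
Local Open Scope ereal_scope.

(* Lebesgue measure on 'rV[R]_n: the n-fold product of lebesgue_measure, built
   by recursion on tuples, is pushed forward to the Borel sets of 'rV[R]_n and
   then completed. Its values on boxes are given by lebesgueRn_box below. *)
Section tuple_lebesgue.
Context {R : realType}.
Local Notation TR := (measurableTypeR R).

Definition tcons n (p : TR * n.-tuple TR) : n.+1.-tuple TR :=
  [tuple of p.1 :: p.2].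

Let measurable_tcons n : measurable_fun setT (@tcons n).
Proof. exact: measurable_cons. Qed.

HB.instance Definition _ n :=
  isMeasurableFun.Build _ _ _ _ (@tcons n) (@measurable_tcons n).

Section step.
Variables (n : nat) (m : {sigma_finite_measure set (n.-tuple TR) -> \bar R}).

Definition tuple_step : set (n.+1.-tuple TR) -> \bar R :=
  pushforward (@lebesgue_measure R \x m) (@tcons n).

Let tuple_step0 : tuple_step set0 = 0.
Proof. exact: measure0. Qed.

Let tuple_step_ge0 A : 0 <= tuple_step A.
Proof. exact: measure_ge0. Qed.

Let mpre A : measurable A -> measurable (@tcons n @^-1` A).
Proof. by move=> mA; rewrite -[X in measurable X]setTI; exact: measurable_tcons. Qed.

Let tuple_step_sigma_additive : semi_sigma_additive tuple_step.
Proof.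
move=> F mF tF mUF; rewrite /tuple_step /pushforward preimage_bigcup.
apply: measure_semi_sigma_additive.
- by move=> k; exact: mpre.
- apply/trivIsetP => /= i j _ _ ij; rewrite -preimage_setI.
  by move/trivIsetP : tF => /(_ _ _ _ _ ij) ->//; rewrite preimage_set0.
- by rewrite -preimage_bigcup; exact: mpre.
Qed.

HB.instance Definition _ := isMeasure.Build _ _ _ tuple_step
  tuple_step0 tuple_step_ge0 tuple_step_sigma_additive.

Let tuple_step_sigma_finite : sigma_finite setT tuple_step.
Proof.
have /sigma_finiteP[F [TF ndF Foo]] := sigma_finiteT (@lebesgue_measure R).
have /sigma_finiteP[G [TG ndG Goo]] := sigma_finiteT m.
pose unc (t : n.+1.-tuple TR) : TR * n.-tuple TR :=
  (thead t, [tuple of behead t]).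
have munc : measurable_fun setT unc.
  apply/measurable_fun_pair; first exact: (measurable_tnth ord0).
  exact: measurable_behead.
have uncK : cancel (@tcons n) unc.
  by move=> [x t]; rewrite /unc /tcons/= theadE; congr pair; exact/val_inj.
exists (fun k => unc @^-1` (F k `*` G k)).
  rewrite -preimage_bigcup; apply/esym/seteqP; split => // t _ /=.
  have : (\bigcup_i F i) (unc t).1 by rewrite -TF.
  have : (\bigcup_i G i) (unc t).2 by rewrite -TG.
  move=> [k _ Gky] [l _ Flx]; exists (maxn l k) => //; split => /=.
  - by move: Flx; exact/subsetPset/ndF/leq_maxl.
  - by move: Gky; exact/subsetPset/ndG/leq_maxr.
move=> k; have [mF Fkoo] := Foo k; have [mG Gkoo] := Goo k; split.
  by rewrite -[X in measurable X]setTI; apply: munc => //; exact: measurableX.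
rewrite /tuple_step /pushforward -comp_preimage (_ : unc \o _ = id); last first.
  by apply/funext => x /=; rewrite uncK.
by rewrite preimage_id product_measure1E// lte_mul_pinfty// ge0_fin_numE.
Qed.

HB.instance Definition _ := Measure_isSigmaFinite.Build _ _ _ tuple_step
  tuple_step_sigma_finite.

End step.

Fixpoint tuple_lebesgue n : {sigma_finite_measure set (n.-tuple TR) -> \bar R} :=
  if n is n'.+1 return {sigma_finite_measure set (n.-tuple TR) -> \bar R}
  then tuple_step (tuple_lebesgue n')
  else \d_([tuple] : 0.-tuple TR).

Lemma tuple_lebesgue_box n (A : 'I_n -> set TR) :
  (forall i, measurable (A i)) ->
  tuple_lebesgue n [set t | forall i, A i (tnth t i)] =
  \prod_(i < n) lebesgue_measure (A i).
Proof.
elim: n A => [|n ih] A mA.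
  rewrite big_ord0 /= diracE mem_set//; by case.
rewrite big_ord_recl -ih//= /tuple_step /pushforward/= -product_measure1E//.
  congr (_ _); apply/seteqP; split=> [[x t]/= H|[x t]/= [H0 H] i].
    split; first by have := H ord0.
    by move=> i; have := H (lift ord0 i); rewrite tnthS.
  by case: (unliftP ord0 i) => [j ->|->]; rewrite ?tnthS.
rewrite (_ : [set _ | _] =
    \bigcap_(i in [set: 'I_n]) ((@tnth _ TR)^~ i @^-1` A (lift ord0 i))).
  apply: fin_bigcap_measurable => // i _.
  by rewrite -[X in measurable X]setTI; exact: measurable_tnth.
by apply/seteqP; split => t /= H i; [move=> _|]; exact: H.
Qed.

End tuple_lebesgue.

Section Rn.
Variables (R : realType) (n : nat).
Local Notation TR := (measurableTypeR R).

Definition borelRn := g_sigma_algebraType (@open 'rV[R]_n).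

Definition row_of_tuple (t : n.-tuple TR) : borelRn := \row_i (tnth t i : R).

Let measurable_row_of_tuple : measurable_fun setT row_of_tuple.
Proof.
have := @measurability _ _ (n.-tuple TR) borelRn setT row_of_tuple (@open 'rV[R]_n) erefl.
apply.
move=> _ [U oU <-]; rewrite setTI.
pose B (p : 'rV[rat]_n * rat) : set 'rV[R]_n :=
  ball (map_mx (@ratr R) p.1 : 'rV[R]_n) (ratr p.2).
have mB p : measurable (row_of_tuple @^-1` B p).
  have [r0|r0] := ltP 0%R (ratr p.2 : R); last first.
    rewrite (_ : _ @^-1` _ = set0)//.
    by apply/seteqP; split=> // t [] /=; rewrite ltNge r0.
  rewrite (_ : _ @^-1` _ = \bigcap_(i in [set: 'I_n])
    ((@tnth _ TR)^~ i @^-1` ball (ratr (p.1 ord0 i) : R) (ratr p.2))).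
    apply: fin_bigcap_measurable => // i _.
    rewrite -[X in measurable X]setTI; apply: measurable_tnth => //.
    by rewrite ball_itv; exact: measurable_itv.
  apply/seteqP; split => [t [_ H] i _ /=|t H].
    by have := H ord0 i; rewrite !mxE.
  by split => // i j; rewrite !mxE ord1; exact: H.
rewrite (_ : U = \bigcup_(p : 'rV[rat]_n * rat)
    (if `[< B p `<=` U >] then B p else set0)).
  rewrite preimage_bigcup; apply: countable_bigcupT_measurable => // p.
  by case: ifP => // _; rewrite preimage_set0.
apply/seteqP; split => [x Ux|x [p _]]; last by case: ifPn => // /asboolP; apply.
have /nbhs_ballP[e /= e0 xeU] : nbhs x U by exact: open_nbhs_nbhs.
have [r] := rat_in_itvoo (divr_gt0 e0 (ltr0Sn R 1)).
rewrite in_itv/= => /andP[r0 re].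
have /choice[q Hq] : forall i, exists q : rat, ball (ratr q : R) (ratr r) (x ord0 i).
  move=> i; have : (x ord0 i - ratr r < x ord0 i + ratr r :> R)%R.
    by rewrite ltrBlDr -addrA ltrDl addr_gt0.
  move=> /rat_in_itvoo[q]; rewrite in_itv/= => Hq; exists q.
  move/andP: Hq => [q1 q2]; rewrite ball_itv/= in_itv/=.
  by apply/andP; split; lra.
have Bx : B (\row_i q i, r) x.
  by split => // i j; rewrite !mxE (ord1 i); exact: Hq.
exists (\row_i q i, r) => //; rewrite ifT//; apply/asboolP => y By.
apply: xeU; rewrite [e]splitr; apply: (@ball_triangle _ _ (map_mx (@ratr R) (\row_i q i))).
  by apply: le_ball (ltW re) _ _; exact: ball_sym.
exact: le_ball (ltW re) _ By.
Qed.

HB.instance Definition _ :=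
  isMeasurableFun.Build _ _ _ _ row_of_tuple measurable_row_of_tuple.

Definition borel_lebesgue : set borelRn -> \bar R :=
  pushforward (tuple_lebesgue n) row_of_tuple.

Let borel_lebesgue0 : borel_lebesgue set0 = 0.
Proof. exact: measure0. Qed.

Let borel_lebesgue_ge0 A : 0 <= borel_lebesgue A.
Proof. exact: measure_ge0. Qed.

Let mpre A : measurable A -> measurable (row_of_tuple @^-1` A).
Proof.
by move=> mA; rewrite -[X in measurable X]setTI; exact: measurable_row_of_tuple.
Qed.

Let borel_lebesgue_sigma_additive : semi_sigma_additive borel_lebesgue.
Proof.
move=> F mF tF mUF; rewrite /borel_lebesgue /pushforward preimage_bigcup.
apply: measure_semi_sigma_additive.
- by move=> k; exact: mpre.
- apply/trivIsetP => /= i j _ _ ij; rewrite -preimage_setI.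
  by move/trivIsetP : tF => /(_ _ _ _ _ ij) ->//; rewrite preimage_set0.
- by rewrite -preimage_bigcup; exact: mpre.
Qed.

HB.instance Definition _ := isMeasure.Build _ _ _ borel_lebesgue
  borel_lebesgue0 borel_lebesgue_ge0 borel_lebesgue_sigma_additive.

(* 'rV[R]_n with the sigma-algebra of the Lebesgue measurable sets *)
Definition lebRn := caratheodory_type (borel_lebesgue^*)%mu.

Definition lebesgueRn : set lebRn -> \bar R :=
  @completed_measure_extension _ borelRn R borel_lebesgue.

HB.instance Definition _ := Measure.on lebesgueRn.

Lemma borel_sub_lebesgue (A : set 'rV[R]_n) :
  measurable (A : set borelRn) -> measurable (A : set lebRn).
Proof. exact: caratheodory_measurable_mu_ext. Qed.

Lemma lebesgueRnE (A : set 'rV[R]_n) :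
  measurable (A : set borelRn) -> lebesgueRn A = borel_lebesgue A.
Proof. exact: measurable_mu_extE. Qed.

Lemma lebesgueRn_box (a b : 'rV[R]_n) : (forall i, a ord0 i <= b ord0 i)%R ->
  lebesgueRn [set x : 'rV[R]_n | forall i, (a ord0 i < x ord0 i < b ord0 i)%R] =
  (\prod_(i < n) (b ord0 i - a ord0 i))%:E.
Proof.
have oB : open [set x : 'rV[R]_n | forall i, (a ord0 i < x ord0 i < b ord0 i)%R].
  rewrite openE => x Hx.
  suff /(filter_forall (nbhs_filter x)) : forall i,
      \forall y \near x, (a ord0 i < (y : 'rV[R]_n) ord0 i < b ord0 i)%R by [].
  move=> i.
  have : nbhs (x ord0 i) `]a ord0 i, b ord0 i[%classic.
    by apply: open_nbhs_nbhs; split; [exact: itv_open|rewrite /= in_itv/=].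
  move=> /(@coord_continuous R 1 n ord0 i x) nx.
  by apply: (@filterS _ _ (nbhs_filter x) _ _ _ nx) => y /=; rewrite in_itv.
move=> ab; rewrite lebesgueRnE; last exact: sub_sigma_algebra.
rewrite /borel_lebesgue /pushforward.
transitivity (\prod_(i < n) lebesgue_measure (`]a ord0 i, b ord0 i[ : set R)).
  rewrite -tuple_lebesgue_box; last by move=> i; exact: measurable_itv.
  congr (tuple_lebesgue n _).
  by apply/seteqP; split => t H i; have := H i; rewrite /= in_itv/= mxE.
rewrite -prodEFin; apply: eq_bigr => i _.
rewrite lebesgue_measure_itv/= lte_fin lt_neqAle ab andbT.
by case: eqVneq => //= ->; rewrite subrr.
Qed.

End Rn.

Section maximal.
Context {R : realType} {n : nat}.
Local Notation V := 'rV[R]_n.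
Local Notation leb := (@lebesgueRn R n).
Implicit Types (x y : V) (A Q : set V) (f : V -> \bar R).

(* Euclidean distance; the norm of the library on 'rV[R]_n is the sup norm *)
Definition edist x y : R :=
  Num.sqrt (\sum_(i < n) (x ord0 i - y ord0 i) ^+ 2)%R.

Definition diam A : R := sup [set edist x y | x in A & y in A].

(* the open cube of centre x and side length 2 * r *)
Definition cube x (r : R) : set V :=
  [set y : V | forall i, (x ord0 i - r < y ord0 i < x ord0 i + r)%R].

Definition is_cube Q : Prop := exists x r, (0 < r)%R /\ Q = cube x r.

(* f may take infinite values, as a maximal function does *)
Definition loc_integrable f : Prop :=
  forall K : set V, compact K -> leb.-integrable K f.

Definition avg f Q : \bar R := (leb Q)^-1 * \int[leb]_(y in Q) f y.

Definition mean_osc f Q : \bar R := avg (fun x => `|f x - avg f Q|) Q.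

Definition borel_loc_finite (mu : set (borelRn R n) -> \bar R) : Prop :=
  forall x, exists U : set V, [/\ open U, U x & mu U < +oo].

Variant maximal_kind := centred | noncentred.

Definition cubes_at (k : maximal_kind) x : set (set V) :=
  match k with
  | centred => [set Q | exists r : R, (0 < r)%R /\ Q = cube x r]
  | noncentred => [set Q | is_cube Q /\ Q x]
  end.

Definition maximal k f x : \bar R :=
  ereal_sup [set avg (fun y => `|f y|) Q | Q in cubes_at k x].

Definition maximal_measure k (mu : set (borelRn R n) -> \bar R) x : \bar R :=
  ereal_sup [set mu Q * (leb Q)^-1 | Q in cubes_at k x].

End maximal.

(* Main.v *)
(* Fix a cube Q of radius r and split Mu according to the radius s of the averaging
   cube P. For s >= r, translating P by y - x turns a cube at x into a cube at y;
   cutting both cubes into cells of radius about r and comparing corresponding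
   cells shows that u_P changes by at most c C r^alpha Mmu(z), so the large part of
   Mu is nearly constant on Q. For s < r, u_P is compared with the mean of u over
   the dyadic subcube of Q of the same scale containing x. If alpha > 0, telescoping
   these means to u_Q gives the majorant
   sum_j (2^-j r)^alpha mu(3 P_j(x)) / |P_j|, whose integral over Q is at most
   c r^alpha mu(3Q) because the cubes 3 P_j of one generation overlap boundedly and
   the scales sum geometrically. If alpha = 0, u is in BMO and a stopping-time
   argument bounds the integral of the dyadic maximal function of u - u_Q. *)

Require Import Defs.
From mathcomp Require Import all_boot all_order all_algebra.
From mathcomp Require Import ring lra.
From mathcomp Require Import all_classical all_reals all_analysis.
From mathcomp Require Import measurable_realfun.

Import Order.TTheory GRing.Theory Num.Theory.
Import numFieldNormedType.Exports.

Set Implicit Arguments.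
Unset Strict Implicit.

Local Open Scope classical_set_scope.
Local Open Scope ring_scope.

(** * Half-open cubes and grids *)

Section hcubes.
Context {R : realType} {n : nat}.
Local Notation V := 'rV[R]_n.
Local Notation leb := (@lebesgueRn R n).
Implicit Types (p q x : V) (r s : R).

(** Half-open, so that a cube is exactly the disjoint union of the cells of a grid. The cubes of the
    theorem are the open [cube p r]. *)
Definition hcube p r : set V :=
  [set y | forall i, p ord0 i - r <= y ord0 i < p ord0 i + r].

Lemma cube_sub_hcube p r : cube p r `<=` hcube p r.
Proof. by move=> x xp i; have /andP[/ltW -> ->] := xp i. Qed.

Lemma sub_hcube p q r s : (forall i, `|p ord0 i - q ord0 i| <= s - r) ->
  hcube p r `<=` hcube q s.
Proof.
move=> pq x xp i; have := xp i; have := pq i; rewrite ler_norml; lra.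
Qed.

Lemma sub_cube p q r s : (forall i, `|p ord0 i - q ord0 i| <= s - r) ->
  cube p r `<=` cube q s.
Proof.
move=> pq x xp i; have := xp i; have := pq i; rewrite ler_norml; lra.
Qed.

Lemma open_coord_preimage (i : 'I_n) (A : set R) :
  open A -> open [set x : V | A (x ord0 i)].
Proof.
move=> oA; have := open_comp _ oA; apply => x _.
exact: (@coord_continuous R 1 n ord0 i x).
Qed.

Lemma measurable_coord_itv (i : 'I_n) (I : interval R) :
  measurable ([set x : V | x ord0 i \in I] : set (borelRn R n)).
Proof.
have mo (A : set R) : open A ->
    measurable ([set x : V | A (x ord0 i)] : set (borelRn R n)).
  by move=> oA; apply: sub_sigma_algebra; exact: open_coord_preimage.
pose phi (x : borelRn R n) : measurableTypeR R := (x : V) ord0 i.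
have mphi : measurable_fun setT phi.
  apply: (measurability _ (RGenOpens.measurableE R)) => _ [_ [a [b ->]] <-].
  by rewrite setTI; apply: mo; exact: interval_open.
rewrite (_ : [set x : V | _] = phi @^-1` [set` I]); last by [].
by rewrite -[X in measurable X]setTI; apply: mphi => //; exact: measurable_itv.
Qed.

Lemma measurable_box (I : 'I_n -> interval R) :
  measurable ([set x : V | forall i, x ord0 i \in I i] : set (borelRn R n)).
Proof.
rewrite (_ : [set _ | _] =
    \bigcap_(i in [set: 'I_n]) [set x : V | x ord0 i \in I i]).
  by apply: fin_bigcap_measurable => // i _; exact: measurable_coord_itv.
by apply/seteqP; split => x H i; [move=> _|]; exact: H.
Qed.

Lemma lebesgue_box (I : 'I_n -> interval R) :
  leb [set x : V | forall i, x ord0 i \in I i] =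
  (\prod_(i < n) lebesgue_measure [set` I i])%E.
Proof.
rewrite lebesgueRnE; last exact: measurable_box.
rewrite /borel_lebesgue /pushforward -tuple_lebesgue_box; last first.
  by move=> i; exact: measurable_itv.
congr (tuple_lebesgue n _).
by apply/seteqP; split => t H i; have := H i; rewrite /= mxE.
Qed.

Lemma hcube_box p r : hcube p r =
  [set x : V | forall i, x ord0 i \in `[p ord0 i - r, p ord0 i + r[].
Proof. by apply/seteqP; split => x H i; have := H i; rewrite in_itv. Qed.

Lemma cube_box p r : cube p r =
  [set x : V | forall i, x ord0 i \in `]p ord0 i - r, p ord0 i + r[].
Proof. by apply/seteqP; split => x H i; have := H i; rewrite in_itv. Qed.

Lemma borel_cube p r : measurable (cube p r : set (borelRn R n)).
Proof. by rewrite cube_box; exact: measurable_box. Qed.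

Lemma borel_hcube p r : measurable (hcube p r : set (borelRn R n)).
Proof. by rewrite hcube_box; exact: measurable_box. Qed.

Lemma measurable_cube p r : measurable (cube p r : set (lebRn R n)).
Proof. by apply: borel_sub_lebesgue; exact: borel_cube. Qed.

Lemma measurable_hcube p r : measurable (hcube p r : set (lebRn R n)).
Proof. by apply: borel_sub_lebesgue; exact: borel_hcube. Qed.

Lemma lebesgue_cube p r : 0 < r -> leb (cube p r) = ((2 * r) ^+ n)%:E.
Proof.
move=> r0; rewrite cube_box lebesgue_box -[in RHS](card_ord n) -prodr_const.
rewrite -prodEFin; apply: eq_bigr => i _.
rewrite lebesgue_measure_itv/= lte_fin ifT; last by lra.
by rewrite -EFinD; congr EFin; lra.
Qed.

Lemma lebesgue_hcube p r : 0 < r -> leb (hcube p r) = ((2 * r) ^+ n)%:E.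
Proof.
move=> r0; rewrite hcube_box lebesgue_box -[in RHS](card_ord n) -prodr_const.
rewrite -prodEFin; apply: eq_bigr => i _.
rewrite lebesgue_measure_itv/= lte_fin ifT; last by lra.
by rewrite -EFinD; congr EFin; lra.
Qed.

(** The two cubes have the same finite volume, so their difference is a null set. *)
Lemma ge0_integral_hcube p r (f : V -> \bar R) : 0 < r ->
  measurable_fun (hcube p r : set (lebRn R n)) f -> (forall x, (0 <= f x)%E) ->
  (\int[leb]_(x in hcube p r) f x = \int[leb]_(x in cube p r) f x)%E.
Proof.
move=> r0 mf f0.
have mN : measurable (hcube p r `\` cube p r : set (lebRn R n)).
  by apply: measurableD; [exact: measurable_hcube|exact: measurable_cube].
rewrite (@ge0_negligible_integral _ _ _ leb (hcube p r) (hcube p r `\` cube p r))//.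
- congr (integral _ _ _); rewrite setDD; apply/setIidPr; exact: cube_sub_hcube.
- exact: measurable_hcube.
- rewrite [LHS]measureD; [|exact: measurable_hcube|exact: measurable_cube|].
    rewrite (setIidPr _ _).2; last exact: cube_sub_hcube.
    rewrite [X in (X - _)%E](lebesgue_hcube p r0).
    by rewrite [X in (_ - X)%E](lebesgue_cube p r0) subee.
  by rewrite [ltLHS](lebesgue_hcube p r0) ltry.
Qed.

Lemma compact_closed_cube p r :
  compact [set x : V | forall i, x ord0 i \in `[p ord0 i - r, p ord0 i + r]].
Proof.
apply: (@rV_compact R n (fun i => [set` `[p ord0 i - r, p ord0 i + r]])) => i.
exact: segment_compact.
Qed.

Lemma loc_integrable_hcube (f : V -> \bar R) p r :
  loc_integrable f -> leb.-integrable (hcube p r) f.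
Proof.
move=> fi; have {}fi := fi _ (@compact_closed_cube p r).
apply: (@integrableS _ _ _ leb _ (hcube p r) f _ _ _ fi).
- by apply: borel_sub_lebesgue; exact: measurable_box.
- exact: measurable_hcube.
- by move=> x xp i; have := xp i; rewrite in_itv/= => /andP[-> /ltW ->].
Qed.

End hcubes.

(** * Integrals and measures over finite disjoint unions *)

Section finite_unions.
Context d (T : measurableType d) (R : realType).
Variables (mu : {measure set T -> \bar R}) (I : finType) (F : I -> set T).
Hypothesis mF : forall i, measurable (F i).
Hypothesis tF : trivIset setT F.

Lemma ge0_integral_fin_bigcup (f : T -> \bar R) :
  measurable_fun (\bigcup_i F i) f -> (forall x, (0 <= f x)%E) ->
  (\int[mu]_(x in \bigcup_i F i) f x = \sum_i \int[mu]_(x in F i) f x)%E.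
Proof.
have -> : \bigcup_i F i = \big[setU/set0]_(i <- index_enum I) F i.
  by rewrite -bigcup_seq; apply: eq_bigcupl; split => i //= _; exact: mem_index_enum.
move=> mf f0; rewrite ge0_integral_bigsetU//; first exact: index_enum_uniq.
by apply: sub_trivIset tF.
Qed.

Lemma measure_fin_bigcupT :
  mu (\bigcup_i F i) = (\sum_i mu (F i))%E.
Proof.
have mUF : measurable (\bigcup_i F i) by apply: fin_bigcup_measurable.
rewrite -[LHS]mul1e -(@integral_cst _ _ _ mu _ mUF 1%E) ge0_integral_fin_bigcup//.
by apply: eq_bigr => i _; rewrite integral_cst// mul1e.
Qed.

End finite_unions.

(** * Tiling a cube by a grid, and overlap of dilated cells *)

Section grids.
Context {R : realType} {n : nat}.
Local Notation V := 'rV[R]_n.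
Local Notation leb := (@lebesgueRn R n).
Implicit Types (p q x : V) (r s : R).

(* Centres of the [N ^ n] half-open cubes of radius [r / N] that tile [hcube p r] *)
Definition grid N p r (i : {ffun 'I_n -> 'I_N}) : V :=
  \row_l (p ord0 l - r + (2 * (i l)%:R + 1) * (r / N%:R)).

Lemma grid_dist N p r (i : {ffun 'I_n -> 'I_N}) l : 0 < r ->
  `|grid p r i ord0 l - p ord0 l| <= r - r / N%:R.
Proof.
move=> r0; rewrite mxE; have iN := ltn_ord (i l).
have N0 : 0 < N%:R :> R by rewrite ltr0n (leq_ltn_trans _ iN).
have : ((i l)%:R + 1 <= N%:R :> R) by rewrite natr1 ler_nat.
have : 0 <= (i l)%:R :> R by [].
have : N%:R * (r / N%:R) = r by rewrite mulrC divfK// gt_eqF.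
have : 0 < r / N%:R by exact: divr_gt0.
set a := r / _; set k := N%:R; set m := _%:R => a0 kar m0 mk; rewrite -/k -/a -/m.
(* The signs of these two products are the only nonlinear facts needed; the rest is linear
   arithmetic in [m * a] and [k * a]. *)
have ma : 0 <= m * a by apply: mulr_ge0 => //; exact: ltW.
have mka : 0 <= (k - (m + 1)) * a by apply: mulr_ge0; [rewrite subr_ge0|exact: ltW].
rewrite ler_norml; lra.
Qed.

Lemma sub_hcube_grid N p r (i : {ffun 'I_n -> 'I_N}) : 0 < r ->
  hcube (grid p r i) (r / N%:R) `<=` hcube p r.
Proof. by move=> r0; apply: sub_hcube => l; exact: grid_dist. Qed.

Lemma trivIset_grid N p r : 0 < r ->
  trivIset setT (fun i : {ffun 'I_n -> 'I_N} => hcube (grid p r i) (r / N%:R)).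
Proof.
move=> r0; apply/trivIsetP => i j _ _ ij; apply/seteqP; split => // x [xi xj].
move/eqP: ij; apply; apply/ffunP => l; apply/val_inj => /=.
have N0 : 0 < N%:R :> R by rewrite ltr0n (leq_ltn_trans _ (ltn_ord (i l))).
have a0 : 0 < r / N%:R by exact: divr_gt0.
(* If cell [a] begins at or before [x] and cell [b] ends after it, then [a <= b]. Using this both
   ways for two cells containing [x] makes their indices equal. *)
have key (a b : nat) : p ord0 l - r + (2 * a%:R + 1) * (r / N%:R) - r / N%:R <=
    x ord0 l -> x ord0 l < p ord0 l - r + (2 * b%:R + 1) * (r / N%:R) + r / N%:R ->
    (a <= b)%N.
  move=> h1 h2; rewrite -ltnS -(ltr_nat R) -natr1 -subr_gt0.
  rewrite -(pmulr_lgt0 _ a0); move: h1 h2; lra.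
have := xi l; have := xj l; rewrite !mxE => /andP[j1 j2] /andP[i1 i2].
by apply/eqP; rewrite eqn_leq (key _ _ i1 j2) (key _ _ j1 i2).
Qed.

Lemma hcube_grid N p r : (0 < N)%N -> 0 < r ->
  hcube p r = \bigcup_(i : {ffun 'I_n -> 'I_N}) hcube (grid p r i) (r / N%:R).
Proof.
move=> N0 r0; apply/seteqP; split => [x xp|x [i _]]; last exact: sub_hcube_grid.
have N0' : 0 < N%:R :> R by rewrite ltr0n.
have a0 : 0 < r / N%:R by exact: divr_gt0.
(* The index is the integer part of the distance from the lower face, measured in cell sides; the
   open upper face keeps it below [N]. *)
have /choice[i Hi] : forall l, exists i : 'I_N,
    i%:R <= (x ord0 l - (p ord0 l - r)) / (2 * (r / N%:R)) < i%:R + 1.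
  move=> l; set t := _ / _.
  have /andP[x1 x2] := xp l.
  have t0 : 0 <= t by apply: divr_ge0; lra.
  have /andP[t1 t2] := truncn_itv t0.
  have tN : (Num.truncn t < N)%N.
    rewrite -(ltr_nat R); apply: (le_lt_trans t1).
    rewrite ltr_pdivrMr; last by lra.
    by rewrite mulrCA (mulrC N%:R) divfK ?gt_eqF//; lra.
  by exists (Ordinal tN); rewrite /= t1 natr1.
exists (finfun i) => // l; have /andP[] := Hi l.
rewrite ler_pdivlMr; last by lra.
rewrite ltr_pdivrMr; last by lra.
rewrite mxE ffunE; lra.
Qed.

Lemma ge0_integral_grid N p r (f : V -> \bar R) : (0 < N)%N -> 0 < r ->
  measurable_fun (hcube p r : set (lebRn R n)) f -> (forall x, (0 <= f x)%E) ->
  (\int[leb]_(x in hcube p r) f x = \sum_(i : {ffun 'I_n -> 'I_N})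
    \int[leb]_(x in hcube (grid p r i) (r / N%:R)) f x)%E.
Proof.
move=> N0 r0; rewrite (hcube_grid p N0 r0) => mf f0.
apply: ge0_integral_fin_bigcup => // [i|]; first exact: measurable_hcube.
exact: trivIset_grid.
Qed.

(* Comparing volumes, at most [k.+1 ^ n] of the disjoint cubes have a [k]-fold
   dilation that contains a given point. *)
Lemma measure_dilated_cubes (mu : {measure set (borelRn R n) -> \bar R})
    (I : finType) (c : I -> V) r k (W : set V) : 0 < r -> (0 < k)%N ->
  trivIset setT (fun i => hcube (c i) r) ->
  measurable (W : set (borelRn R n)) ->
  (forall i, cube (c i) (k%:R * r) `<=` W) ->
  (\sum_i mu (cube (c i) (k%:R * r)) <= (k.+1%:R ^+ n)%:E * mu W)%E.
Proof.
move=> r0 k0 tc mW cW; set A := fun i => cube (c i) (k%:R * r).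
have k0' : 0 < k%:R :> R by rewrite ltr0n.
have kr0 : 0 < k%:R * r by exact: mulr_gt0.
have mA i : measurable (A i : set (borelRn R n)) by exact: borel_cube.
(* [F] keeps the cells whose dilation contains [y]. They are disjoint and lie in the cube of radius
   [k.+1 * r] about [y], so volumes bound their number. *)
have pack y : \sum_i \1_(A i) y <= k.+1%:R ^+ n :> R.
  pose F i : set V := if y \in A i then hcube (c i) r else set0.
  have mF i : measurable (F i : set (lebRn R n)).
    by rewrite /F; case: ifP => _; [exact: measurable_hcube|exact: measurable0].
  have tF : trivIset setT F.
    apply/trivIsetP => i j _ _ ij; rewrite /F.
    case: ifP; last by rewrite set0I.
    case: ifP; last by rewrite setI0.
    by move=> _ _; move/trivIsetP : tc; exact.
  have r2 : 0 < (2 * r) ^+ n by rewrite exprn_gt0//; lra.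
  rewrite -(ler_pM2r r2) -exprMn -lee_fin.
  rewrite (_ : k.+1%:R * _ = 2 * (k.+1%:R * r)); last by ring.
  have kr1 : 0 < k.+1%:R * r by rewrite mulr_gt0.
  rewrite -(lebesgue_hcube y kr1).
  apply: (@le_trans _ _ (leb (\bigcup_i F i))); last first.
    apply: le_measure; rewrite ?inE.
    - exact: fin_bigcup_measurable.
    - exact: measurable_hcube.
    apply: bigcup_sub => i _; rewrite /F; case: ifPn => [|_]; last exact: sub0set.
    rewrite inE => Ay.
    apply: sub_hcube => l; have := Ay l; rewrite -natr1 mulrDl mul1r ler_norml.
    by lra.
  rewrite [leRHS](@measure_fin_bigcupT _ _ _ leb)// mulr_suml -sumEFin.
  apply: lee_sum => i _; rewrite /F indicE; case: ifPn => _.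
    by rewrite mul1r [leRHS](lebesgue_hcube _ r0).
  by rewrite mul0r measure0.
(* The pointwise overlap bound is now integrated against [mu] over [W]. *)
have mAE i : mu (A i) = (\int[mu]_(x in W) (\1_(A i) x)%:E)%E.
  by rewrite integral_indic//; congr (mu _); apply/esym/setIidPl; exact: cW.
rewrite (eq_bigr _ (fun i _ => mAE i)) -ge0_integral_sum//; last first.
  by move=> i; apply/measurable_EFinP; exact: measurable_indic.
rewrite -(@integral_cst _ _ _ mu)//; apply: ge0_le_integral => //.
- by move=> x _; apply: sume_ge0.
- by apply: emeasurable_sum => i; apply/measurable_EFinP; exact: measurable_indic.
- by move=> x _; rewrite sumEFin lee_fin; exact: pack.
Qed.

End grids.

(** * Mean oscillation over neighbouring cubes *)

Section oscillation.
Context {R : realType} {n : nat}.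
Local Notation V := 'rV[R]_n.
Local Notation leb := (@lebesgueRn R n).
Implicit Types (p q x : V) (r s c : R).

Variable u : V -> R.
Hypothesis u0 : forall x, 0 <= u x.
Hypothesis ui : forall p r, leb.-integrable (hcube p r) (EFin \o u).

(** Not divided by the volume, hence monotone in the cube and additive over a grid. *)
Definition absdev c p r : R := \int[leb]_(x in hcube p r) `|u x - c|.

Definition cube_mean p r : R :=
  (\int[leb]_(x in hcube p r) u x) / (2 * r) ^+ n.

Definition osc p r : R := absdev (cube_mean p r) p r.

Lemma vol_gt0 r : 0 < r -> 0 < (2 * r) ^+ n.
Proof. by move=> r0; rewrite exprn_gt0//; lra. Qed.

Lemma lebesgue_hcube_lty p r : 0 < r -> (leb (hcube p r) < +oo)%E.
Proof. by move=> r0; rewrite [ltLHS](lebesgue_hcube p r0) ltry. Qed.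

Lemma integrable_cst_hcube c p r : 0 < r ->
  leb.-integrable (hcube p r) (EFin \o cst c).
Proof.
move=> r0; apply/integrableP; split; first exact: (measurable_cst c%:E).
have mh : measurable (hcube p r : set (lebRn R n)) by exact: measurable_hcube.
rewrite (integral_cst leb mh `|c%:E|%E) lte_mul_pinfty ?lee_fin//.
exact: lebesgue_hcube_lty.
Qed.

Lemma integrable_sub_cst c p r : 0 < r ->
  leb.-integrable (hcube p r) (fun x => (u x - c)%:E).
Proof.
move=> r0; have mh : measurable (hcube p r : set (lebRn R n)) by exact: measurable_hcube.
rewrite (_ : (fun _ => _) = (EFin \o u) \- (EFin \o cst c))%E; last first.
  by apply/funext => x /=; rewrite EFinB.
apply: integrableB => //.
exact: integrable_cst_hcube.
Qed.

Lemma integrable_absdev c p r : 0 < r ->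
  leb.-integrable (hcube p r) (fun x => `|u x - c|%:E).
Proof.
move=> r0; apply: (integrable_abse (integrable_sub_cst c p r0)).
Qed.

Lemma absdev_ge0 c p r : 0 <= absdev c p r.
Proof. by apply: Rintegral_ge0. Qed.

Lemma EFin_absdev c p r : 0 < r ->
  (\int[leb]_(x in hcube p r) `|u x - c|%:E)%E = (absdev c p r)%:E.
Proof.
move=> r0; rewrite /absdev /Rintegral fineK//.
by apply: integrable_fin_num; [exact: measurable_hcube|exact: integrable_absdev].
Qed.

Lemma cube_meanK p r : 0 < r ->
  cube_mean p r * (2 * r) ^+ n = \int[leb]_(x in hcube p r) u x.
Proof. by move=> r0; rewrite /cube_mean divfK// gt_eqF// vol_gt0. Qed.

(** The left side is the absolute value of the integral of [u - c]. *)
Lemma cube_mean_sub_le c p r : 0 < r ->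
  `|cube_mean p r - c| * (2 * r) ^+ n <= absdev c p r.
Proof.
move=> r0; have mh : measurable (hcube p r : set (lebRn R n)) by exact: measurable_hcube.
rewrite -[X in _ * X]ger0_norm; last exact/ltW/vol_gt0.
rewrite -normrM mulrBl cube_meanK//.
have -> : c * (2 * r) ^+ n = \int[leb]_(x in hcube p r) c.
  by rewrite Rintegral_cst//= [X in fine X](lebesgue_hcube p r0).
rewrite -RintegralB//; last exact: integrable_cst_hcube.
by apply: le_normr_Rintegral => //; exact: integrable_sub_cst.
Qed.

Lemma absdev_subset c p q r s : 0 < r -> 0 < s -> hcube p r `<=` hcube q s ->
  absdev c p r <= absdev c q s.
Proof.
move=> r0 s0 pq; rewrite -lee_fin -!EFin_absdev//.
apply: ge0_subset_integral; [exact: measurable_hcube..| | |exact: pq].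
  by have /integrableP[] := integrable_absdev c q s0.
by move=> x _; rewrite lee_fin.
Qed.

Lemma cube_mean_sub_osc p q r s : 0 < r -> 0 < s -> hcube p r `<=` hcube q s ->
  `|cube_mean p r - cube_mean q s| * (2 * r) ^+ n <= osc q s.
Proof.
move=> r0 s0 pq; apply: le_trans (cube_mean_sub_le _ _ r0) _.
exact: absdev_subset.
Qed.

Lemma absdev_grid c N p r : (0 < N)%N -> 0 < r ->
  absdev c p r =
  \sum_(i : {ffun 'I_n -> 'I_N}) absdev c (grid p r i) (r / N%:R).
Proof.
move=> N0 r0; apply: EFin_inj; rewrite -sumEFin -EFin_absdev//.
have rN0 : 0 < r / N%:R by rewrite divr_gt0// ltr0n.
rewrite (ge0_integral_grid N0 r0); last 2 first.
- by have /integrableP[] := integrable_absdev c p r0.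
- by move=> x; rewrite lee_fin.
by apply: eq_bigr => i _; rewrite EFin_absdev.
Qed.

Lemma cube_mean_grid N p r : (0 < N)%N -> 0 < r ->
  cube_mean p r * (2 * r) ^+ n = \sum_(i : {ffun 'I_n -> 'I_N})
    cube_mean (grid p r i) (r / N%:R) * (2 * (r / N%:R)) ^+ n.
Proof.
move=> N0 r0; rewrite cube_meanK//.
have rN0 : 0 < r / N%:R by rewrite divr_gt0// ltr0n.
have E q s : 0 < s ->
    (\int[leb]_(x in hcube q s) u x)%:E = (\int[leb]_(x in hcube q s) (u x)%:E)%E.
  move=> s0; rewrite /Rintegral fineK//.
  by apply: integrable_fin_num; [exact: measurable_hcube|exact: ui].
apply: EFin_inj; rewrite -sumEFin E// (ge0_integral_grid N0 r0); last 2 first.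
- by have /integrableP[] := ui p r.
- by move=> x; rewrite lee_fin.
by apply: eq_bigr => i _; rewrite cube_meanK// E.
Qed.

(* The [i]-th cells of the two grids lie in one cube of three times their radius,
   so no telescoping through larger cubes is needed and [alpha = 1] loses no
   logarithm. *)
Lemma cube_mean_translate N p (v : V) s : (0 < N)%N -> 0 < s ->
  (forall l, `|v ord0 l| <= 2 * (s / N%:R)) ->
  `|cube_mean p s - cube_mean (p + v) s| * (2 * s) ^+ n <=
  2 * \sum_(i : {ffun 'I_n -> 'I_N}) osc (grid p s i) (3 * (s / N%:R)).
Proof.
move=> N0 s0 vN; rewrite -[X in _ * X]ger0_norm; last exact/ltW/vol_gt0.
rewrite -normrM mulrBl !(cube_mean_grid _ N0 s0) -sumrB.
apply: le_trans (ler_norm_sum _ _ _) _; rewrite mulr_sumr.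
apply: ler_sum => i _; set a := s / _.
have a0 : 0 < a by rewrite divr_gt0// ltr0n.
have a3 : 0 < 3 * a by rewrite mulr_gt0.
rewrite -mulrBl normrM [X in _ * X]ger0_norm; last exact/ltW/vol_gt0.
set c := cube_mean (grid p s i) (3 * a).
have h1 : `|cube_mean (grid p s i) a - c| * (2 * a) ^+ n <= osc (grid p s i) (3 * a).
  apply: cube_mean_sub_osc => //; apply: sub_hcube => l.
  by rewrite subrr normr0; lra.
have h2 : `|cube_mean (grid (p + v) s i) a - c| * (2 * a) ^+ n <=
    osc (grid p s i) (3 * a).
  apply: cube_mean_sub_osc => //; apply: sub_hcube => l.
  rewrite !mxE -/a (_ : _ - _ = v ord0 l); last by ring.
  by have := vN l; rewrite -/a; lra.
apply: (@le_trans _ _ ((`|cube_mean (grid p s i) a - c| +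
   `|cube_mean (grid (p + v) s i) a - c|) * (2 * a) ^+ n)); last first.
  by rewrite mulrDl; lra.
apply: ler_wpM2r; first exact/ltW/vol_gt0.
by rewrite (distrC (cube_mean (grid (p + v) s i) a)); exact: ler_distD.
Qed.

Variables (mu : {measure set (borelRn R n) -> \bar R}) (D : R -> R).
Hypothesis D0 : forall r, 0 <= D r.
Hypothesis oscD : forall p r, 0 < r ->
  ((osc p r)%:E <= (D r)%:E * mu (cube p r))%E.

(** The tripled cells lie in the tripled cube and overlap at most [4 ^+ n] times, so their
    [mu]-measures add up to at most [4 ^+ n] times that of the tripled cube, whatever [N] is. *)
Lemma sum_osc_grid N p r : (0 < N)%N -> 0 < r ->
  ((\sum_(i : {ffun 'I_n -> 'I_N}) osc (grid p r i) (3 * (r / N%:R)))%:E <=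
   (D (3 * (r / N%:R)) * 4 ^+ n)%:E * mu (cube p (3 * r)))%E.
Proof.
move=> N0 r0; set a := r / _.
have a0 : 0 < a by rewrite divr_gt0// ltr0n.
have ar : a <= r by rewrite ler_pdivrMr ?ltr0n// ler_peMr ?(ltW r0)// ler1n.
have a3 : 0 < 3 * a by rewrite mulr_gt0.
rewrite -sumEFin.
apply: (@le_trans _ _ (\sum_(i : {ffun 'I_n -> 'I_N})
    (D (3 * a))%:E * mu (cube (grid p r i) (3 * a)))%E).
  by apply: lee_sum => i _; exact: oscD.
rewrite -ge0_sume_distrr; last by move=> i _; exact: measure_ge0.
rewrite EFinM -muleA; apply: lee_wpmul2l; first by rewrite lee_fin.
apply: (@measure_dilated_cubes _ _ mu _ (fun i => grid p r i) a 3%N) => //.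
- exact: trivIset_grid.
- exact: borel_cube.
- move=> i; apply: sub_cube => l; apply: le_trans (grid_dist p i l r0) _.
  rewrite -/a; lra.
Qed.

End oscillation.

(** Serves for [tree_max], whose recursion follows a different child on each cell. *)
Lemma measurable_fun_fin_bigcup d d' (T : measurableType d) (T' : measurableType d')
    (I : finType) (F : I -> set T) (f : T -> T') :
  (forall i, measurable (F i)) -> (forall i, measurable_fun (F i) f) ->
  measurable_fun (\bigcup_i F i) f.
Proof.
move=> mF mf _ Y mY; rewrite setI_bigcupl.
by apply: fin_bigcup_measurable => // i _; exact: mf.
Qed.

(** * The dyadic maximal function in BMO *)

Section dyadic_maximal.
Context {R : realType} {n : nat}.
Local Notation V := 'rV[R]_n.
Local Notation leb := (@lebesgueRn R n).
Implicit Types (p q x : V) (r s c v : R).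

Variable u : V -> R.
Hypothesis u0 : forall x, 0 <= u x.
Hypothesis ui : forall p r, leb.-integrable (hcube p r) (EFin \o u).

(* Centre of the dyadic child of [hcube p r] that contains [x] *)
Definition child p r x : V :=
  \row_l (if p ord0 l <= x ord0 l then p ord0 l + r / 2 else p ord0 l - r / 2).

Lemma child_mem p r x : hcube p r x -> hcube (child p r x) (r / 2) x.
Proof. by move=> px l; have := px l; rewrite mxE; case: (leP (p ord0 l)); lra. Qed.

(** [child] is constant on each of the [2 ^ n] cells, so functions defined by descending through
    [child] can be measured and integrated cell by cell. *)
Lemma child_grid p r x (i : {ffun 'I_n -> 'I_2}) : 0 < r ->
  hcube (grid p r i) (r / 2) x -> child p r x = grid p r i.
Proof.
move=> r0 xi; apply/rowP => l; have := xi l; rewrite !mxE.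
by case: (i l) => -[|[|//]] ?/=; case: (leP (p ord0 l)); lra.
Qed.

(* [tree_max v N p r x]: largest [|u_P - v|] over the dyadic subcubes [P] of
   [hcube p r] containing [x], down to generation [N] *)
Fixpoint tree_max v (N : nat) p r x : R :=
  if N is N'.+1 then
    Num.max `|cube_mean u p r - v| (tree_max v N' (child p r x) (r / 2) x)
  else `|cube_mean u p r - v|.

Lemma tree_max_ge0 v N p r x : 0 <= tree_max v N p r x.
Proof. by case: N => //= N; rewrite le_max normr_ge0. Qed.

Lemma tree_max_nd v N p r x : tree_max v N p r x <= tree_max v N.+1 p r x.
Proof.
elim: N p r => [|N ih] p r /=; first by rewrite le_max lexx.
by rewrite ge_max le_max lexx/= le_max; apply/orP; right; exact: ih.
Qed.

(** Allows the reference value to be replaced by a stopped cube's own mean when the argument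
    restarts inside that cube. *)
Lemma tree_max_shift v w N p r x : tree_max v N p r x <= `|w - v| + tree_max w N p r x.
Proof.
elim: N p r => [|N ih] p r /=; first by rewrite [leRHS]addrC; exact: ler_distD.
rewrite ge_max; apply/andP; split.
  apply: le_trans (ler_distD w _ _) _; rewrite [leLHS]addrC lerD2l.
  by rewrite le_max lexx.
by apply: le_trans (ih _ _) _; rewrite lerD2l le_max lexx orbT.
Qed.

Lemma tree_max_cube v N p r x : 0 < r -> hcube p r x ->
  exists q, hcube q (r / 2 ^+ N) x /\ 
    `|cube_mean u q (r / 2 ^+ N) - v| <= tree_max v N p r x.
Proof.
elim: N p r => [|N ih] p r r0 px.
  by exists p; rewrite expr0 divr1.
have r20 : 0 < r / 2 by rewrite divr_gt0.
have [q [qx qm]] := ih _ _ r20 (child_mem px).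
exists q; rewrite exprS invfM mulrA; split => //=.
by apply: le_trans qm _; rewrite le_max lexx orbT.
Qed.

Lemma measurable_tree_max v N p r : 0 < r ->
  measurable_fun (hcube p r : set (lebRn R n)) (tree_max v N p r).
Proof.
elim: N p r => [|N ih] p r r0; first exact: measurable_cst.
have r20 : 0 < r / 2 by rewrite divr_gt0.
rewrite (@hcube_grid _ _ 2)//; apply: measurable_fun_fin_bigcup.
  by move=> i; exact: measurable_hcube.
move=> i; apply: (eq_measurable_fun
    (fun x : lebRn R n => Num.max `|cube_mean u p r - v|
      (tree_max v N (grid p r i) (r / 2) x))).
  by move=> x; rewrite inE => /(child_grid r0) <-.
by apply: measurable_maxr; [exact: measurable_cst|exact: ih].
Qed.

Variable K : R.
Hypothesis K0 : 0 < K.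
Hypothesis bmo : forall p r, 0 < r -> osc u p r <= K * (2 * r) ^+ n.

(** A child has [2 ^- n] times the volume of its parent, whence the factor [2 ^+ n]. *)
Lemma child_mean p r (i : {ffun 'I_n -> 'I_2}) : 0 < r ->
  `|cube_mean u (grid p r i) (r / 2) - cube_mean u p r| <= 2 ^+ n * K.
Proof.
move=> r0; have r20 : 0 < r / 2 by rewrite divr_gt0.
rewrite -(ler_pM2r (vol_gt0 (n := n) r20)).
apply: le_trans (cube_mean_sub_osc ui r20 r0 (sub_hcube_grid (i := i) r0)) _.
apply: le_trans (bmo _ r0) _.
by rewrite mulrAC -exprMn [leRHS]mulrC (_ : 2 * (2 * (r / 2)) = 2 * r)//; lra.
Qed.

(* One step of John-Nirenberg: descend until a subcube [P] satisfies
   [|u_P - v| > lam]; Chebyshev bounds the total volume of these subcubes, and [B]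
   controls the oscillation inside each of them. *)
Lemma stopping_time_bound (lam B : R) (M : nat) v : 0 < lam ->
  (forall N p r, (N <= M)%N -> 0 < r ->
    (\int[leb]_(x in hcube p r) (tree_max (cube_mean u p r) N p r x)%:E <=
      (B * (2 * r) ^+ n)%:E)%E) ->
  forall N p r, (N <= M.+1)%N -> 0 < r -> `|cube_mean u p r - v| <= lam ->
    (\int[leb]_(x in hcube p r) (Num.max lam (tree_max v N p r x))%:E <=
     (lam * (2 * r) ^+ n + (2 ^+ n * K + B) / lam * absdev u v p r)%:E)%E.
Proof.
move=> lam0 HB; elim=> [|N ih] p r NM r0 pv.
  have mh := @measurable_hcube R n p r.
  rewrite (eq_integral (cst lam%:E)); last by move=> x _ /=; rewrite max_l.
  rewrite integral_cst// [X in (_ * X)%E](lebesgue_hcube p r0) -EFinM lee_fin.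
  rewrite lerDl mulr_ge0 ?absdev_ge0// divr_ge0 ?(ltW lam0)//.
  rewrite addr_ge0 ?mulr_ge0 ?exprn_ge0 ?(ltW K0)//.
  (* [B] bounds the integral of a nonnegative function divided by the volume, which gives the
     required sign. *)
  have := HB 0%N p r isT r0.
  have : (0 <= \int[leb]_(x in hcube p r) (tree_max (cube_mean u p r) 0 p r x)%:E)%E.
    by apply: integral_ge0 => x _; rewrite lee_fin tree_max_ge0.
  move=> /le_trans /[apply]; rewrite lee_fin pmulr_lge0//; exact: vol_gt0.
have r20 : 0 < r / 2 by rewrite divr_gt0.
have mtm N' q s w : 0 < s ->
    measurable_fun (hcube q s : set (lebRn R n)) (fun x => Num.max lam (tree_max w N' q s x)).
  by move=> s0; apply: measurable_maxr; [exact: measurable_cst|exact: measurable_tree_max].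
rewrite (ge0_integral_grid (isT : (0 < 2)%N) r0); last 2 first.
- by apply/measurable_EFinP; exact: mtm.
- by move=> x; rewrite lee_fin le_max (ltW lam0).
rewrite (absdev_grid ui v (N := 2) p isT r0).
have -> : (2 * r) ^+ n = \sum_(i : {ffun 'I_n -> 'I_2}) (2 * (r / 2)) ^+ n.
  rewrite sumr_const card_ffun !card_ord -[RHS]mulr_natl natrX -exprMn.
  by congr (_ ^+ _); lra.
rewrite !mulr_sumr -big_split/= -sumEFin; apply: lee_sum => i _.
set q := grid p r i.
rewrite (eq_integral (fun x : lebRn R n =>
    (Num.max lam (tree_max v N q (r / 2) x))%:E)); last first.
  move=> x; rewrite inE => /(child_grid r0) ->.
  by rewrite maxA (max_l pv).
(* A child whose mean is still within [lam] of [v] is handled by induction; otherwise the descent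
   stops at it. *)
have [qv|qv] := leP `|cube_mean u q (r / 2) - v| lam; first exact: ih (ltnW NM) _ _.
have mh := @measurable_hcube R n q (r / 2).
(* The parent was not stopped, so the mean of the stopped child is within [lam + 2 ^+ n * K] of [v];
   below it only deviations from its own mean remain, and [HB] applies. *)
apply: (@le_trans _ _ (\int[leb]_(x in hcube q (r / 2))
    ((lam + 2 ^+ n * K)%:E + (tree_max (cube_mean u q (r / 2)) N q (r / 2) x)%:E))%E).
  have A0 : 0 <= lam + 2 ^+ n * K by rewrite addr_ge0 ?mulr_ge0 ?exprn_ge0 ?ltW.
  apply: ge0_le_integral.
  - exact: mh.
  - by move=> x _; rewrite lee_fin le_max (ltW lam0).
  - by apply/measurable_EFinP; exact: mtm.
  - apply: emeasurable_funD; first exact: measurable_cst.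
    by apply/measurable_EFinP; exact: measurable_tree_max.
  move=> x _; rewrite -EFinD lee_fin.
  have t0 := tree_max_ge0 (cube_mean u q (r / 2)) N q (r / 2) x.
  rewrite ge_max; apply/andP; split.
    by rewrite -addrA lerDl addr_ge0// mulr_ge0 ?exprn_ge0 ?ltW.
  apply: le_trans (tree_max_shift v (cube_mean u q (r / 2)) N q (r / 2) x) _.
  rewrite lerD2r; apply: le_trans (ler_distD (cube_mean u p r) _ _) _.
  by rewrite [leLHS]addrC lerD//; exact: child_mean.
rewrite ge0_integralD; last 5 first.
- exact: mh.
- by move=> x _; rewrite lee_fin addr_ge0 ?mulr_ge0 ?exprn_ge0 ?ltW.
- exact: measurable_cst.
- by move=> x _; rewrite lee_fin tree_max_ge0.
- by apply/measurable_EFinP; exact: measurable_tree_max.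
rewrite (integral_cst leb mh (lam + 2 ^+ n * K)%:E).
rewrite [X in (_ * X + _)%E](lebesgue_hcube q r20).
apply: (@le_trans _ _ ((lam + 2 ^+ n * K) * (2 * (r / 2)) ^+ n +
    B * (2 * (r / 2)) ^+ n)%:E).
  by rewrite [leRHS]EFinD EFinM leeD2l//; exact: HB.
rewrite lee_fin -mulrDl -addrA mulrDl lerD2l.
have KB0 : 0 <= 2 ^+ n * K + B.
  rewrite addr_ge0 ?mulr_ge0 ?exprn_ge0 ?(ltW K0)//.
  have := HB N q _ NM r20.
  have : (0 <= \int[leb]_(x in hcube q (r / 2))
      (tree_max (cube_mean u q (r / 2)) N q (r / 2) x)%:E)%E.
    by apply: integral_ge0 => x _; rewrite lee_fin tree_max_ge0.
  move=> /le_trans /[apply]; rewrite lee_fin pmulr_lge0//; exact: vol_gt0.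
(* Chebyshev: since [lam] is less than the deviation of the mean from [v], the volume of the stopped
   cube is at most [absdev] over it divided by [lam]. *)
rewrite -mulrA ler_wpM2l// ler_pdivlMl//.
apply: le_trans _ (cube_mean_sub_le ui v q r20).
by apply: ler_wpM2r; [exact/ltW/vol_gt0|exact: ltW].
Qed.

(** Strong induction on the number of generations, with a bound that does not grow with [N]. *)
Lemma tree_max_bound N p r : 0 < r ->
  (\int[leb]_(x in hcube p r) (tree_max (cube_mean u p r) N p r x)%:E <=
    ((4 + 2 ^+ n) * K * (2 * r) ^+ n)%:E)%E.
Proof.
have [M] := ubnP N; elim: M N p r => // -[_|M ih] [|N] // p r NM r0.
- rewrite (eq_integral (cst 0%E)); last by move=> x _ /=; rewrite subrr normr0.
  by rewrite integral0 lee_fin ?mulr_ge0 ?addr_ge0 ?exprn_ge0 ?mulr_ge0 ?ltW.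
- rewrite (eq_integral (cst 0%E)); last by move=> x _ /=; rewrite subrr normr0.
  by rewrite integral0 lee_fin ?mulr_ge0 ?addr_ge0 ?exprn_ge0 ?mulr_ge0 ?ltW.
(* At level [2 * K] only half of the inductive bound [B] is carried over, and [B = (4 + 2 ^+ n) * K]
   solves [B = 2 * K + (2 ^+ n * K + B) / 2]. *)
have lam0 : 0 < 2 * K by rewrite mulr_gt0.
have HB N' q s : (N' <= N)%N -> 0 < s ->
    (\int[leb]_(x in hcube q s) (tree_max (cube_mean u q s) N' q s x)%:E <=
    ((4 + 2 ^+ n) * K * (2 * s) ^+ n)%:E)%E.
  by move=> N'N s0; apply: ih => //; exact: leq_ltn_trans N'N _.
have mx w : measurable_fun (hcube p r : set (lebRn R n)) (fun x => tree_max w N.+1 p r x).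
  exact: measurable_tree_max.
apply: (@le_trans _ _ (\int[leb]_(x in hcube p r) (Num.max (2 * K)
    (tree_max (cube_mean u p r) N.+1 p r x))%:E)%E).
  have mh := @measurable_hcube R n p r.
  apply: ge0_le_integral.
  - exact: mh.
  - by move=> x _; rewrite lee_fin tree_max_ge0.
  - by apply/measurable_EFinP; exact: mx.
  - by apply/measurable_EFinP; apply: measurable_maxr; [exact: measurable_cst|exact: mx].
  - by move=> x _; rewrite lee_fin le_max lexx orbT.
have h := @stopping_time_bound _ _ _ (cube_mean u p r) lam0 HB _ p _ (leqnn N.+1) r0.
apply: le_trans (h _) _; first by rewrite subrr normr0 ltW.
rewrite lee_fin.
set k := _ / (2 * K).
have -> : k = 2 + 2 ^+ n by rewrite /k; field; lra.
have k0 : 0 <= 2 + 2 ^+ n :> R by rewrite addr_ge0 ?exprn_ge0.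
apply: (@le_trans _ _ (2 * K * (2 * r) ^+ n + (2 + 2 ^+ n) * (K * (2 * r) ^+ n))).
  by rewrite lerD2l; apply: ler_wpM2l => //; exact: bmo.
by rewrite le_eqVlt; apply/orP; left; apply/eqP; ring.
Qed.

(** The dyadic maximal function of [u] minus its mean on the cube, with the absolute value outside
    the averages. It is a monotone limit and may be infinite. *)
Definition tree_sup p r x : \bar R :=
  limn (fun N => (tree_max (cube_mean u p r) N p r x)%:E).

Lemma tree_max_nondecreasing p r x :
  nondecreasing_seq (fun N => (tree_max (cube_mean u p r) N p r x)%:E).
Proof.
by apply/nondecreasing_seqP => N; rewrite lee_fin; exact: tree_max_nd.
Qed.

Lemma tree_sup_ge N p r x :
  ((tree_max (cube_mean u p r) N p r x)%:E <= tree_sup p r x)%E.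
Proof.
rewrite /tree_sup.
have /cvg_lim -> // := ereal_nondecreasing_cvgn (@tree_max_nondecreasing p r x).
by apply: ereal_sup_ubound; exists N.
Qed.

Lemma measurable_tree_sup p r : 0 < r ->
  measurable_fun (hcube p r : set (lebRn R n)) (tree_sup p r).
Proof.
move=> r0; apply: (emeasurable_fun_cvg
  (fun N (x : lebRn R n) => (tree_max (cube_mean u p r) N p r x)%:E)).
  by move=> N; apply/measurable_EFinP; exact: measurable_tree_max.
move=> x _; apply: ereal_nondecreasing_is_cvgn.
exact: tree_max_nondecreasing.
Qed.

Lemma integral_tree_sup p r : 0 < r ->
  (\int[leb]_(x in hcube p r) tree_sup p r x <=
    ((4 + 2 ^+ n) * K * (2 * r) ^+ n)%:E)%E.
Proof.
move=> r0; have mh := @measurable_hcube R n p r.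
have mt N : measurable_fun (hcube p r : set (lebRn R n))
    (fun x => (tree_max (cube_mean u p r) N p r x)%:E).
  by apply/measurable_EFinP; exact: measurable_tree_max.
rewrite (monotone_convergence leb mh mt); last 2 first.
- by move=> N x _; rewrite lee_fin tree_max_ge0.
- by move=> x _; exact: tree_max_nondecreasing.
apply: lime_le.
  apply: ereal_nondecreasing_is_cvgn; apply/nondecreasing_seqP => N.
  apply: ge0_le_integral.
  - exact: mh.
  - by move=> x _; rewrite lee_fin tree_max_ge0.
  - exact: mt.
  - exact: mt.
  - by move=> x _; rewrite lee_fin tree_max_nd.
by apply: nearW => N; exact: tree_max_bound.
Qed.

End dyadic_maximal.

(** * Oscillation of the maximal function *)

Section mean_oscillation.
Context {R : realType} {n : nat}.
Local Notation V := 'rV[R]_n.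
Local Notation leb := (@lebesgueRn R n).

Lemma avg_cube (f : V -> \bar R) p r : 0 < r ->
  measurable_fun (hcube p r : set (lebRn R n)) f -> (forall x, (0 <= f x)%E) ->
  avg f (cube p r) = (((2 * r) ^+ n)^-1%:E * \int[leb]_(x in hcube p r) f x)%E.
Proof.
move=> r0 mf f0; rewrite /avg [X in (X^-1)%E](lebesgue_cube p r0) ge0_integral_hcube//.
by rewrite inver gt_eqF// vol_gt0.
Qed.

(** Replacing the mean by an arbitrary constant [a] costs a factor 2, since the mean is itself
    within [B] of [a]. *)
Lemma mean_osc_le (f : V -> \bar R) p r (a B : R) : 0 < r ->
  leb.-integrable (hcube p r) f -> (forall x, (0 <= f x)%E) ->
  (\int[leb]_(x in hcube p r) `|f x - a%:E| <= (B * (2 * r) ^+ n)%:E)%E ->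
  (mean_osc f (cube p r) <= (2 * B)%:E)%E.
Proof.
move=> r0 fi f0 HB; have mh := @measurable_hcube R n p r.
have /integrableP[mf _] := fi.
have v0 := vol_gt0 (n := n) r0.
have ai : leb.-integrable (hcube p r) (EFin \o cst a).
  exact: integrable_cst_hcube.
have [phi phiE] : exists phi : R, (\int[leb]_(x in hcube p r) f x)%E = (phi * (2 * r) ^+ n)%:E.
  exists (fine (\int[leb]_(x in hcube p r) f x)%E / (2 * r) ^+ n).
  by rewrite divfK ?gt_eqF// fineK//; exact: integrable_fin_num.
have avgE : avg f (cube p r) = phi%:E.
  by rewrite avg_cube// phiE -EFinM mulrC mulfK// gt_eqF.
have dev c : measurable_fun (hcube p r : set (lebRn R n)) (fun x => `|f x - c%:E|%E).
  apply: (@measurableT_comp _ _ _ _ _ _ abse); first exact: abse_measurable.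
  by apply: emeasurable_funB; [exact: mf|exact: measurable_cst].
have pa : `|phi - a| <= B.
  rewrite -(ler_pM2r v0) -lee_fin; apply: le_trans HB.
  rewrite -[X in _ * X]ger0_norm ?(ltW v0)// -normrM mulrBl.
  rewrite -abse_EFin EFinB -phiE EFinM -[X in (a%:E * X)%E](lebesgue_hcube p r0).
  rewrite -(integral_cst leb mh a%:E) -integralB//.
  apply: le_abse_integral; first exact: mh.
  by apply: emeasurable_funB; [exact: mf|exact: measurable_cst].
rewrite /mean_osc avgE avg_cube//.
rewrite lee_pdivrMl// -EFinM.
apply: (@le_trans _ _ (\int[leb]_(x in hcube p r) (`|f x - a%:E| + `|a - phi|%:E))%E).
  apply: ge0_le_integral.
  - exact: mh.
  - by move=> x _; exact: abse_ge0.
  - exact: dev.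
  - by apply: emeasurable_funD; [exact: dev|exact: measurable_cst].
  move=> x _; rewrite (_ : f x - phi%:E = (f x - a%:E) + (a - phi)%:E)%E.
    by rewrite (le_trans (lee_abs_add _ _)).
  by case: (f x) => [y| |]//=; rewrite -!EFinD; congr EFin; ring.
rewrite ge0_integralD//.
rewrite (integral_cst leb mh `|a - phi|%:E) [X in (_ + _ * X)%E](lebesgue_hcube p r0).
rewrite -EFinM (_ : _ * (2 * B) = B * (2 * r) ^+ n + B * (2 * r) ^+ n); last by ring.
rewrite EFinD leeD// lee_fin ler_wpM2r ?(ltW v0)//.
by rewrite distrC.
Qed.

End mean_oscillation.

(** * Comparison of nearby cubes and the averages defining the two maximal functions *)

Section neighbouring_cubes.
Context {R : realType} {n : nat}.
Local Notation V := 'rV[R]_n.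
Local Notation leb := (@lebesgueRn R n).
Implicit Types (p q x : V) (r s t : R).

Variable u : V -> R.
Hypothesis u0 : forall x, 0 <= u x.
Hypothesis ui : forall p r, leb.-integrable (hcube p r) (EFin \o u).

(** Both cubes lie in [hcube q (3 * t)] and have volume at least [t ^+ n], so each mean is compared
    with the mean over that cube. *)
Lemma cube_mean_near p q x s t : 0 < s -> s <= t <= 2 * s ->
  hcube q t x -> (forall l, `|p ord0 l - x ord0 l| <= s) ->
  `|cube_mean u p s - cube_mean u q t| <= 2 * (osc u q (3 * t) / t ^+ n).
Proof.
move=> s0 /andP[st ts] qx px.
have t0 : 0 < t by exact: lt_le_trans st.
have t3 : 0 < 3 * t by rewrite mulr_gt0.
have tn0 : 0 < t ^+ n by rewrite exprn_gt0.
have key p' s' : 0 < s' -> t <= 2 * s' -> hcube p' s' `<=` hcube q (3 * t) ->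
    `|cube_mean u p' s' - cube_mean u q (3 * t)| <= osc u q (3 * t) / t ^+ n.
  move=> s'0 ts' sub; rewrite ler_pdivlMr//.
  apply: le_trans (cube_mean_sub_osc ui s'0 t3 sub).
  by apply: ler_wpM2l => //; apply: lerXn2r; rewrite ?nnegrE; lra.
apply: le_trans (ler_distD (cube_mean u q (3 * t)) _ _) _.
rewrite [leRHS]mulr_natl mulr2n lerD//; last rewrite distrC; apply: key => //.
- apply: sub_hcube => l; have := qx l; have := px l; rewrite !ler_norml; lra.
- lra.
- by apply: sub_hcube => l; rewrite subrr normr0; lra.
Qed.

(** Describes the cubes of [cubes_at k x] by centre and radius, so that one argument serves both
    operators. *)
Definition centred_at (k : maximal_kind) x p s : Prop :=
  match k with centred => p = x | noncentred => cube p s x end.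

Lemma centred_at_self k x s : 0 < s -> centred_at k x x s.
Proof. by case: k => //= s0 l; lra. Qed.

Lemma centred_at_dist k x p s l : 0 < s -> centred_at k x p s ->
  `|p ord0 l - x ord0 l| <= s.
Proof.
case: k => /= s0; first by move=> ->; rewrite subrr normr0 ltW.
by move=> /(_ l); rewrite ler_norml; lra.
Qed.

Lemma centred_at_translate k x y p s :
  centred_at k x p s -> centred_at k y (p + (y - x)) s.
Proof.
case: k => /= [->|px l]; first by rewrite addrC subrK.
by have := px l; rewrite !mxE; lra.
Qed.

Lemma avg_cube_mean p s : 0 < s ->
  avg (fun y => `|(EFin \o u) y|%E) (cube p s) = (cube_mean u p s)%:E.
Proof.
move=> s0; rewrite (_ : (fun y => _) = EFin \o u); last first.
  by apply/funext => y /=; rewrite ger0_norm.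
have /integrableP[mf _] := ui p s.
rewrite avg_cube// /cube_mean EFinM muleC; congr (_ * _)%E.
rewrite /Rintegral fineK//.
by apply: integrable_fin_num; [exact: measurable_hcube|exact: ui].
Qed.

Lemma cube_mean_le_maximal k x p s : 0 < s -> centred_at k x p s ->
  ((cube_mean u p s)%:E <= maximal k (EFin \o u) x)%E.
Proof.
move=> s0 xp; rewrite -avg_cube_mean//; apply: ereal_sup_ubound.
exists (cube p s) => //; case: k xp => /= xp; first by exists s; rewrite xp.
by split => //; exists p, s.
Qed.

Lemma maximal_le k x b :
  (forall p s, 0 < s -> centred_at k x p s -> ((cube_mean u p s)%:E <= b)%E) ->
  (maximal k (EFin \o u) x <= b)%E.
Proof.
move=> H; apply: ge_ereal_sup => _ [Q HQ <-].
case: k H HQ => /= H; first by move=> [s [s0 ->]]; rewrite avg_cube_mean//; exact: H.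
by move=> [[p [s [s0 ->]]] xp]; rewrite avg_cube_mean//; exact: H.
Qed.

Lemma maximal_ge0 k x : (0 <= maximal k (EFin \o u) x)%E.
Proof.
apply: le_trans (cube_mean_le_maximal ltr01 (centred_at_self k x ltr01)).
rewrite lee_fin divr_ge0//; exact: Rintegral_ge0.
Qed.

End neighbouring_cubes.

(** * Reduction to an integrable majorant for the small cubes *)

Section maximal_oscillation.
Context {R : realType} {n : nat}.
Local Notation V := 'rV[R]_n.
Local Notation leb := (@lebesgueRn R n).
Implicit Types (p q x : V) (r s t : R).

Variable u : V -> R.
Hypothesis u0 : forall x, 0 <= u x.
Hypothesis ui : forall p r, leb.-integrable (hcube p r) (EFin \o u).
Variables (mu : {measure set (borelRn R n) -> \bar R}) (D : R -> R).
Hypothesis D0 : forall r, 0 <= D r.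
Hypothesis D_nd : forall r s, 0 < r -> r <= s -> D r <= D s.
Hypothesis oscD : forall p r, 0 < r ->
  ((osc u p r)%:E <= (D r)%:E * mu (cube p r))%E.
Variables (z : V) (m : R).
Hypothesis mu_m : forall s, 0 < s -> (mu (cube z s) <= (m * (2 * s) ^+ n)%:E)%E.

Lemma density_ge0 : 0 <= m.
Proof.
have := mu_m ltr01; have := measure_ge0 mu (cube z 1).
move=> /le_trans /[apply]; rewrite lee_fin mulr1 pmulr_lge0// exprn_gt0.
Qed.

Lemma sum_osc_grid_le N p r s : (0 < N)%N -> 0 < r -> 0 < s ->
  (forall l, `|p ord0 l - z ord0 l| <= s - 3 * r) ->
  \sum_(i : {ffun 'I_n -> 'I_N}) osc u (grid p r i) (3 * (r / N%:R)) <=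
  D (3 * (r / N%:R)) * 4 ^+ n * (m * (2 * s) ^+ n).
Proof.
move=> N0 r0 s0 pz; rewrite -lee_fin.
apply: le_trans (sum_osc_grid D0 oscD p N0 r0) _.
rewrite [leRHS]EFinM; apply: lee_wpmul2l; first by rewrite lee_fin mulr_ge0 ?exprn_ge0.
apply: le_trans (mu_m s0).
by apply: le_measure; rewrite ?inE; [exact: borel_cube|exact: borel_cube|exact: sub_cube].
Qed.

(** In [24 = 4 * 6], the 4 comes from the overlap of tripled cells and the 6 from the volume of
    [cube z (6 * s)] relative to the averaging cube; tripled cells have radius at most [6 * r]. *)
Definition translation_error r : R := 2 * 24 ^+ n * D (6 * r) * m.

(** The oscillation bound [D] is applied at the scale of the cells, not of the cube, so the error
    does not depend on [s]. *)
Lemma large_cube_translate p (v : V) r s : 0 < r -> r <= s ->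
  (forall l, `|p ord0 l - z ord0 l| <= 3 * s) ->
  (forall l, `|v ord0 l| <= 2 * r) ->
  `|cube_mean u p s - cube_mean u (p + v) s| <= translation_error r.
Proof.
move=> r0 rs pz vr; have s0 : 0 < s by exact: lt_le_trans rs.
have sr1 : 1 <= s / r by rewrite ler_pdivlMr// mul1r.
have sr0 : 0 <= s / r by rewrite (le_trans _ sr1).
(* This gives cells of radius between [r] and [2 * r]: large enough for the shift [v] to be at most
   a cell side, small enough for [D (6 * r)]. *)
pose N := Num.truncn (s / r).
have /andP[N1 N2] := truncn_itv sr0; rewrite -/N in N1 N2.
have N0 : (0 < N)%N by rewrite /N truncn_gt0.
have N0' : 0 < N%:R :> R by rewrite ltr0n.
have N1' : 1 <= N%:R :> R by rewrite ler1n.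
have ra : r <= s / N%:R.
  by rewrite ler_pdivlMr// mulrC -ler_pdivlMr.
have ar : s / N%:R <= 2 * r.
  rewrite ler_pdivrMr//; move: N2; rewrite ltr_pdivrMr// -natr1.
  have : r <= N%:R * r by rewrite ler_peMl// ltW.
  lra.
rewrite -(ler_pM2r (vol_gt0 (n := n) s0)).
apply: le_trans (cube_mean_translate u0 ui p N0 s0 _) _.
  by move=> l; apply: le_trans (vr l) _; rewrite ler_pM2l.
(* The centre is within [3 * s] of [z], so the tripled cube lies in [cube z (6 * s)], where [mu_m]
   applies. *)
apply: (@le_trans _ _ (2 * (D (3 * (s / N%:R)) * 4 ^+ n * (m * (2 * (6 * s)) ^+ n)))).
  rewrite ler_pM2l//; apply: sum_osc_grid_le => // [|l]; first exact: mulr_gt0.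
  by apply: le_trans (pz l) _; lra.
have m0 := density_ge0.
rewrite (_ : 2 * (_ * _ * (m * _)) =
    D (3 * (s / N%:R)) * (2 * 24 ^+ n * m * (2 * s) ^+ n)); last first.
  rewrite (_ : 2 * (6 * s) = 6 * (2 * s)); last by ring.
  rewrite exprMn (_ : 24 = 4 * 6); last by ring.
  by rewrite [(4 * 6) ^+ n]exprMn; ring.
rewrite /translation_error [leRHS](_ : _ =
    D (6 * r) * (2 * 24 ^+ n * m * (2 * s) ^+ n)); last by ring.
apply: ler_wpM2r.
  by rewrite !mulr_ge0 ?exprn_ge0 ?mulr_ge0// ltW.
by apply: D_nd; lra.
Qed.

Variables (q : V) (r : R).
Hypothesis r0 : 0 < r.
Hypothesis qz : cube q r z.
Variables (g : V -> \bar R) (G : R).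
Hypothesis mg : measurable_fun (hcube q r : set (lebRn R n)) g.
Hypothesis g0 : forall x, (0 <= g x)%E.
Hypothesis intg : (\int[leb]_(x in hcube q r) g x <= (G * (2 * r) ^+ n)%:E)%E.
Hypothesis majorant : forall x j, hcube q r x -> exists p, hcube p (r / 2 ^+ j) x /\
  ((`|cube_mean u p (r / 2 ^+ j) - cube_mean u q r| +
     2 * (osc u p (3 * (r / 2 ^+ j)) / (r / 2 ^+ j) ^+ n))%:E <= g x)%E.

(** The averaging cube is compared with the dyadic cube at [x] of the nearest larger radius;
    [majorant] pays for this step and for the way from there to the mean over the whole cube. *)
Lemma small_cube_le k x p s : hcube q r x -> 0 < s -> s < r ->
  centred_at k x p s -> ((cube_mean u p s)%:E <= (cube_mean u q r)%:E + g x)%E.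
Proof.
move=> qx s0 sr xp.
have exJ : exists J, r / 2 ^+ J <= s.
  exists (Num.truncn (r / s)).
  have /andP[_ h] := truncn_itv (ltW (divr_gt0 r0 s0)).
  rewrite ler_pdivrMr ?exprn_gt0// mulrC -ler_pdivrMr//.
  apply: (le_trans (ltW h)); rewrite -natrX ler_nat.
  exact: ltn_expl.
have [J Js Jmin] := ex_minnP exJ.
(* [J] is not 0 because [s < r], and by minimality the generation before it has radius [t] with
   [s < t <= 2 * s]. *)
case: J Js Jmin => [|j]; first by rewrite expr0 divr1 leNgt sr.
move=> js jmin; set t := r / 2 ^+ j.
have st : s < t.
  by rewrite ltNge; apply/negP => /jmin; rewrite ltnn.
have ts : t <= 2 * s.
  by move: js; rewrite exprS invfM mulrCA -/t; lra.
have [c [cx hc]] := majorant j qx; rewrite -/t in cx hc.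
have st2 : s <= t <= 2 * s by rewrite (ltW st).
have h := cube_mean_near ui s0 st2 cx (fun l => centred_at_dist (k := k) l s0 xp).
rewrite -leeBlDl//; apply: le_trans hc.
rewrite -EFinB lee_fin.
have := ler_norm (cube_mean u c t - cube_mean u q r).
have := ler_norm (cube_mean u p s - cube_mean u c t).
lra.
Qed.

(** On the cube, [a - e <= Mu <= a + e + g] for one constant [a]; integrating gives the bound
    through [mean_osc_le]. *)
Lemma maximal_mean_osc_le k : loc_integrable (maximal k (EFin \o u)) ->
  (mean_osc (maximal k (EFin \o u)) (cube q r) <=
    (2 * (translation_error r + G))%:E)%E.
Proof.
move=> Mi; set Mu := maximal k _.
have mh := @measurable_hcube R n q r.
have Mui : leb.-integrable (hcube q r) Mu by exact: loc_integrable_hcube.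
have /integrableP[mM _] := Mui.
set e := translation_error r.
(* [Mu] is integrable over a set of positive measure, hence finite somewhere; such a point makes the
   supremum [M2] finite. *)
have [x0 [x0q Mx0]] : exists x0, hcube q r x0 /\ (Mu x0 < +oo)%E.
  apply: contrapT => noex.
  have Moo x : hcube q r x -> Mu x = +oo%E.
    move=> xq; apply/eqP; rewrite -leye_eq leNgt; apply/negP => h.
    by apply: noex; exists x.
  have : (\int[leb]_(x in hcube q r) Mu x)%E \is a fin_num by exact: integrable_fin_num.
  rewrite (eq_integral (cst +oo%E)); last by move=> x; rewrite inE => /Moo.
  rewrite integral_cst// [X in (_ * X)%E](lebesgue_hcube q r0).
  by rewrite gt0_mulye// lte_fin vol_gt0.
have trans x y p s : hcube q r x -> hcube q r y -> r <= s -> centred_at k x p s ->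
    `|cube_mean u p s - cube_mean u (p + (y - x)) s| <= e.
  move=> qx qy rs xp; have s0 : 0 < s by exact: lt_le_trans rs.
  apply: (large_cube_translate r0 rs) => l.
    have := centred_at_dist l s0 xp; have := qx l; have := qz l.
    by rewrite !ler_norml; lra.
  by rewrite !mxE ler_norml; have := qx l; have := qy l; lra.
(* The part of the maximal function at [x0] coming from cubes larger than [Q] is
   almost constant on [Q]; [a] is its value. *)
pose M2 : \bar R := ereal_sup [set t | exists p s,
  [/\ r <= s, centred_at k x0 p s & t = (cube_mean u p s)%:E]].
have M2_ge p s : r <= s -> centred_at k x0 p s -> ((cube_mean u p s)%:E <= M2)%E.
  by move=> rs xp; apply: ereal_sup_ubound; exists p, s.
have [a aE] : exists a : R, M2 = a%:E.
  exists (fine M2); rewrite fineK// fin_real//; apply/andP; split.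
    by apply: lt_le_trans (M2_ge x0 r (lexx _) (centred_at_self k x0 r0)); rewrite ltNyr.
  apply: le_lt_trans Mx0; apply: ge_ereal_sup => _ [p [s [rs xp ->]]].
  by apply: cube_mean_le_maximal => //; exact: lt_le_trans rs.
have lower x : hcube q r x -> (a%:E - e%:E <= Mu x)%E.
  move=> qx; rewrite leeBlDr// -aE; apply: ge_ereal_sup => _ [p [s [rs xp ->]]].
  have s0 : 0 < s by exact: lt_le_trans rs.
  have := cube_mean_le_maximal u0 ui s0 (centred_at_translate x xp).
  rewrite -/Mu => /leeD2r h; apply: le_trans (h e%:E).
  rewrite -EFinD lee_fin.
  have := trans _ _ _ _ x0q qx rs xp; rewrite ler_norml; lra.
have upper x : hcube q r x -> (Mu x <= a%:E + e%:E + g x)%E.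
  move=> qx; apply: maximal_le => // p s s0 xp.
  have [rs|sr] := leP r s.
    apply: (@le_trans _ _ (a%:E + e%:E)%E); last by rewrite leeDl.
    have := M2_ge _ _ rs (centred_at_translate x0 xp).
    rewrite aE -EFinD !lee_fin.
    by have := trans _ _ _ _ qx x0q rs xp; rewrite ler_norml; lra.
  apply: le_trans (small_cube_le qx s0 sr xp) _; rewrite leeD2r//.
  (* The cube itself has radius [r], so translated to [x0] it is among the large ones and its mean
     is at most [a + e]. *)
  have qq : hcube q r q by move=> l; lra.
  have := M2_ge _ _ (lexx r) (centred_at_translate x0 (centred_at_self k q r0)).
  rewrite aE -EFinD !lee_fin.
  have := trans _ _ _ _ qq x0q (lexx r) (centred_at_self k q r0); rewrite ler_norml; lra.
apply: (@mean_osc_le _ _ _ _ _ a) => //; first by move=> x; exact: maximal_ge0.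
have e0 : 0 <= e.
  by rewrite !mulr_ge0 ?exprn_ge0 ?D0 ?density_ge0.
apply: (@le_trans _ _ (\int[leb]_(x in hcube q r) (e%:E + g x))%E).
  apply: ge0_le_integral.
  - exact: mh.
  - by move=> x _; exact: abse_ge0.
  - apply: (@measurableT_comp _ _ _ _ _ _ abse); first exact: abse_measurable.
    by apply: emeasurable_funB; [exact: mM|exact: measurable_cst].
  - by apply: emeasurable_funD; [exact: measurable_cst|exact: mg].
  move=> x qx; have := lower x qx; have := upper x qx.
  have := g0 x; case: (g x) => [y| |]//=; last by move=> *; exact: leey.
  case: (Mu x) => [w| |]//=.
  rewrite -!EFinD !lee_fin ler_norml; lra.
rewrite ge0_integralD; [|exact: mh|by []|exact: measurable_cst|by []|exact: mg].
rewrite (integral_cst leb mh e%:E) [X in (_ * X + _)%E](lebesgue_hcube q r0).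
by rewrite (mulrDl e G) EFinD EFinM leeD2l.
Qed.

End maximal_oscillation.

(** * The case of positive [alpha]: a geometric sum over scales *)

Lemma geometric_nneseries_le (R : realType) (b t : R) (f : nat -> \bar R) :
  0 <= b -> 0 <= t < 1 ->
  (forall j, (0 <= f j)%E) -> (forall j, (f j <= (b * t ^+ j)%:E)%E) ->
  (\sum_(j <oo) f j <= (b / (1 - t))%:E)%E.
Proof.
move=> b0 /andP[t0 t1] f0 fb; apply: lime_le; first exact: is_cvg_nneseries.
apply: nearW => N; apply: (@le_trans _ _ (\sum_(0 <= j < N) (b * t ^+ j)%:E)%E).
  exact: lee_sum.
rewrite sumEFin lee_fin -mulr_sumr; apply: ler_wpM2l => //.
have t1' : 0 < 1 - t by rewrite subr_gt0.
rewrite -[leRHS]mul1r ler_pdivlMr// big_mkord.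
have -> : (\sum_(j < N) t ^+ j) * (1 - t) = 1 - t ^+ N.
  by elim: N => [|N ih]; rewrite ?big_ord0 ?big_ord_recr/= ?mulrDl ?ih ?exprS; ring.
by rewrite gerBl exprn_ge0.
Qed.

Lemma powRX (R : realType) (a x : R) j : 0 <= x -> (x ^+ j) `^ a = (x `^ a) ^+ j.
Proof.
move=> x0; elim: j => [|j ih]; first by rewrite !expr0 powR1.
by rewrite !exprS powRM ?exprn_ge0// ih.
Qed.

Section powers.
Context {R : realType} {n : nat}.
Local Notation V := 'rV[R]_n.
Local Notation leb := (@lebesgueRn R n).
Implicit Types (p q x : V) (r s t : R).

Variable u : V -> R.
Hypothesis u0 : forall x, 0 <= u x.
Hypothesis ui : forall p r, leb.-integrable (hcube p r) (EFin \o u).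
Variables (mu : {measure set (borelRn R n) -> \bar R}) (C1 alpha : R).
Hypothesis C0 : 0 < C1.
Hypothesis a0 : 0 <= alpha.
Let D r := C1 * r `^ alpha.
Hypothesis oscD : forall p r, 0 < r ->
  ((osc u p r)%:E <= (D r)%:E * mu (cube p r))%E.
Variables (z : V) (m : R).
Hypothesis mu_m : forall s, 0 < s -> (mu (cube z s) <= (m * (2 * s) ^+ n)%:E)%E.
Variables (q : V) (r : R).
Hypothesis r0 : 0 < r.
Hypothesis qz : cube q r z.
Variable k : maximal_kind.
Hypothesis Mi : loc_integrable (maximal k (EFin \o u)).

Let D0 t : 0 <= D t.
Proof. by rewrite mulr_ge0 ?powR_ge0// ltW. Qed.

Let D_nd s t : 0 < s -> s <= t -> D s <= D t.
Proof.
move=> s0 st; apply: ler_wpM2l; first exact: ltW.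
by apply: ge0_ler_powR => //; rewrite nnegrE ltW//; exact: lt_le_trans st.
Qed.

Let m0 : 0 <= m.
Proof. exact: density_ge0 mu_m. Qed.

Lemma maximal_mean_osc_powR :
  0 < alpha ->
  (mean_osc (maximal k (EFin \o u)) (cube q r) <=
    (2 * (2 * 24 ^+ n * 6 `^ alpha + 2 * 32 ^+ n * 3 `^ alpha / (1 - 2^-1 `^ alpha)) *
      (C1 * r `^ alpha * m))%:E)%E.
Proof.
move=> ap.
have mh := @measurable_hcube R n q r.
have mI p t : measurable (hcube p t : set (lebRn R n)) by exact: measurable_hcube.
pose rad j := r / (2 ^ j)%N%:R.
have radE j : rad j = r / 2 ^+ j by rewrite /rad natrX.
have N0 j : (0 < 2 ^ j)%N by rewrite expn_gt0.
have rad0 j : 0 < rad j by rewrite /rad divr_gt0// ltr0n.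
(* The error term of [cube_mean_near] at generation [j]; [h j] takes this value on each cell of that
   generation. *)
pose a j p := 2 * (osc u p (3 * rad j) / rad j ^+ n).
have apos j p : 0 <= a j p.
  by rewrite mulr_ge0// divr_ge0 ?absdev_ge0// exprn_ge0// ltW.
pose h j (x : V) : \bar R := (\sum_(i : {ffun 'I_n -> 'I_(2 ^ j)})
  (a j (grid q r i) * \1_(hcube (grid q r i) (rad j)) x)%:E)%E.
have t0 j (i : {ffun 'I_n -> 'I_(2 ^ j)}) x :
    (0 <= (a j (grid q r i) * \1_(hcube (grid q r i) (rad j)) x)%:E)%E.
  by rewrite lee_fin mulr_ge0.
have h0 j x : (0 <= h j x)%E by apply: sume_ge0.
have mt j (i : {ffun 'I_n -> 'I_(2 ^ j)}) : measurable_fun (hcube q r : set (lebRn R n))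
    (fun x => (a j (grid q r i) * \1_(hcube (grid q r i) (rad j)) x)%:E).
  apply/measurable_EFinP; apply: measurable_funM; first exact: measurable_cst.
  by apply: measurable_indic; exact: mI.
have mhj j : measurable_fun (hcube q r : set (lebRn R n)) (h j).
  by apply: emeasurable_sum => i; exact: mt.
pose g (x : V) : \bar R := (\sum_(j <oo) h j x)%E.
have th0 : 0 <= 2^-1 `^ alpha :> R by exact: powR_ge0.
have th1 : 2^-1 `^ alpha < 1 :> R.
  rewrite -[ltRHS]/((fun=> 1) alpha) -powR1.
  by apply: gt0_ltr_powR => //; rewrite ?nnegrE ?invr_ge0//; lra.
pose G := 2 * 32 ^+ n * 3 `^ alpha / (1 - 2^-1 `^ alpha) * (C1 * r `^ alpha * m).
(* In [32 = 2 * 4 * 4] the factors come from the cell volume, the overlap of tripled cells, and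
   [cube z (4 * r)], which contains the tripled cube. The power of the radius gives the ratio of the
   geometric series. *)
have inth j : (\int[leb]_(x in hcube q r) h j x <=
    ((2 * 32 ^+ n * 3 `^ alpha * (C1 * r `^ alpha * m) * (2 * r) ^+ n) *
      (2^-1 `^ alpha) ^+ j)%:E)%E.
  rewrite ge0_integral_sum//.
  apply: (@le_trans _ _ (\sum_(i : {ffun 'I_n -> 'I_(2 ^ j)})
      (2 * 2 ^+ n * osc u (grid q r i) (3 * rad j))%:E)%E).
    apply: lee_sum => i _.
    rewrite (eq_integral (fun x : lebRn R n =>
      ((a j (grid q r i))%:E * (\1_(hcube (grid q r i) (rad j)) x)%:E)%E)); last first.
      by move=> x _; rewrite -EFinM.
    rewrite ge0_integralZl_EFin; last 4 first.
    - exact: mh.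
    - by move=> x _; rewrite lee_fin.
    - by apply/measurable_EFinP; apply: measurable_indic; exact: mI.
    - exact: apos.
    rewrite (integral_indic leb mh (mI _ _)).
    rewrite (setIidPl _ _).2; last exact: sub_hcube_grid.
    rewrite [X in (_ * X)%E](lebesgue_hcube _ (rad0 j)) -EFinM lee_fin.
    rewrite /a le_eqVlt; apply/orP; left; apply/eqP.
    move: (rad j) (rad0 j) => t tpos; rewrite [(2 * t) ^+ n]exprMn; field.
    by rewrite expf_neq0// gt_eqF.
  rewrite sumEFin lee_fin -mulr_sumr.
  have s0 : 0 < 4 * r by rewrite mulr_gt0.
  have qz' l : `|q ord0 l - z ord0 l| <= 4 * r - 3 * r.
    by have := qz l; rewrite ler_norml; lra.
  have := sum_osc_grid_le D0 oscD mu_m (N0 j) r0 s0 qz'.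
  rewrite -/(rad j) => H; apply: (le_trans (ler_wpM2l _ H)).
    by rewrite mulr_ge0 ?exprn_ge0.
  rewrite /D radE -exprVn powRM ?mulr_ge0 ?exprn_ge0 ?invr_ge0 ?(ltW r0)//.
  rewrite powRM ?exprn_ge0 ?invr_ge0 ?(ltW r0)// powRX ?invr_ge0//.
  rewrite (_ : 2 * (4 * r) = 4 * (2 * r)); last by ring.
  rewrite [(4 * (2 * r)) ^+ n]exprMn.
  rewrite (_ : 32 = 2 * 4 * 4); last by ring.
  rewrite ![(_ * 4) ^+ n]exprMn.
  by rewrite le_eqVlt; apply/orP; left; apply/eqP; ring.
have := @maximal_mean_osc_le _ _ u u0 ui mu D D0 D_nd oscD z m mu_m q r r0 qz g G _ _ _ _ k Mi.
rewrite /translation_error => H; apply: le_trans (H _ _ _ _) _.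
- apply: (@ge0_emeasurable_sum _ (lebRn R n) R _ h xpredT) => [j x _ _|j _].
    exact: h0.
  exact: mhj.
- by move=> x; apply: nneseries_ge0 => j _ _; exact: h0.
- rewrite (integral_nneseries leb mh mhj) => [|j x _]; last exact: h0.
  apply: le_trans (geometric_nneseries_le _ _ _ inth) _.
  + by rewrite !mulr_ge0 ?exprn_ge0 ?mulr_ge0 ?powR_ge0 ?(ltW C0) ?(ltW r0).
  + by rewrite th0.
  + by move=> j; apply: integral_ge0 => x _; exact: h0.
  rewrite lee_fin /G le_eqVlt; apply/orP; left; apply/eqP; field.
  by rewrite subr_eq0 eq_sym lt_eqF.
- move=> x j qx.
  have cell l : exists i : {ffun 'I_n -> 'I_(2 ^ l)}, hcube (grid q r i) (rad l) x.
    by move: qx; rewrite {1}(hcube_grid q (N0 l) r0) => -[i _ ?]; exists i.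
  (* [P l] is the centre of the cell of generation [l] containing [x]; the last clause makes the
     chain start at the cube itself. *)
  have /choice[P HP] : forall l, exists p, [/\ hcube p (rad l) x,
      ((a l p)%:E <= h l x)%E & (l = 0%N -> p = q)].
    move=> l; have [i xi] := cell l; exists (grid q r i); split => //.
      have E : (a l (grid q r i) * \1_(hcube (grid q r i) (rad l)) x)%:E =
          (a l (grid q r i))%:E.
        by rewrite indicE mem_set ?mulr1.
      rewrite /h (bigD1 i (isT : xpredT i)) E; apply: leeDl.
      by apply: sume_ge0 => i' _; exact: t0.
    move=> l0; subst l; apply/rowP => c; rewrite mxE.
    have -> : (i c : nat) = 0%N by case: (i c) => -[].
    by rewrite expn0 divr1 mulr0 add0r mul1r subrK.
  have chain l : `|cube_mean u (P l) (rad l) - cube_mean u q r| <=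
      \sum_(0 <= i < l) a i (P i).
    elim: l => [|l ih].
      have [_ _ ->//] := HP 0%N.
      by rewrite radE expr0 divr1 subrr normr0 big_geq.
    rewrite big_nat_recr//=; apply: le_trans (ler_distD (cube_mean u (P l) (rad l)) _ _) _.
    rewrite addrC lerD//.
    have [Px _ _] := HP l; have [Px' _ _] := HP l.+1.
    have rS : rad l = 2 * rad l.+1.
      by rewrite !radE exprS; field; rewrite expf_neq0.
    have sl0 := rad0 l.+1.
    apply: (cube_mean_near ui sl0 _ Px) => [|c]; first by rewrite rS lexx andbT; lra.
    by have := Px' c; rewrite ler_norml; lra.
  exists (P j); rewrite -radE; have [Px _ _] := HP j; split => //.
  (* Terms below [j] pay for the telescoping, and term [j] for the extra comparison in
     [majorant]. *)
  apply: le_trans (nneseries_lim_ge j.+1 (fun l _ _ => h0 l x)).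
  apply: (@le_trans _ _ (\sum_(0 <= l < j.+1) (a l (P l))%:E)%E).
    rewrite sumEFin lee_fin big_nat_recr//= lerD2r; exact: chain.
  by apply: lee_sum => l _; have [] := HP l.
rewrite lee_fin /G /D powRM ?(ltW r0)//.
by rewrite le_eqVlt; apply/orP; left; apply/eqP; ring.
Qed.

End powers.

(** * The case [alpha = 0] *)

Section bounded_mean_oscillation.
Context {R : realType} {n : nat}.
Local Notation V := 'rV[R]_n.
Local Notation leb := (@lebesgueRn R n).
Implicit Types (p q x : V) (r s t : R).

Lemma maximal_mean_osc_bmo (u : V -> R) (mu : {measure set (borelRn R n) -> \bar R})
    (K : R) (z : V) (m : R) (q : V) r (k : maximal_kind) :
  (forall x, 0 <= u x) ->
  (forall p r, leb.-integrable (hcube p r) (EFin \o u)) ->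
  0 < K ->
  (forall p t, 0 < t -> mu (cube p t) = ((2 * t) ^+ n)%:E) ->
  (forall p t, 0 < t -> ((osc u p t)%:E <= K%:E * mu (cube p t))%E) ->
  (forall s, 0 < s -> (mu (cube z s) <= (m * (2 * s) ^+ n)%:E)%E) ->
  0 < r -> cube q r z -> loc_integrable (maximal k (EFin \o u)) ->
  (mean_osc (maximal k (EFin \o u)) (cube q r) <=
    (2 * (2 * 24 ^+ n + 2 * 6 ^+ n + 4 + 2 ^+ n) * (K * m))%:E)%E.
Proof.
move=> u0 ui K0 mul oscK mu_m r0 qz Mi.
have mh := @measurable_hcube R n q r.
(* On cubes [mu] is the volume, so its density bound [m] is at least 1, and bounds by [K] become
   bounds by [K * m]. *)
have m1 : 1 <= m.
  by have := mu_m 1 ltr01; rewrite mul// lee_fin ler_pMl.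
have bmo p t : 0 < t -> osc u p t <= K * (2 * t) ^+ n.
  by move=> t0; rewrite -lee_fin EFinM -(mul p t t0); exact: oscK.
have c0 : 0 <= 2 * 6 ^+ n * K by rewrite !mulr_ge0 ?exprn_ge0 ?ltW.
(* The constant covers the comparison term, as [bmo] on a tripled cube gives [6 ^+ n * K];
   [tree_sup] covers the dyadic means. *)
pose g (x : V) := ((2 * 6 ^+ n * K)%:E + tree_sup u q r x)%E.
have ts0 x : (0 <= tree_sup u q r x)%E.
  apply: le_trans (tree_sup_ge u 0 q r x).
  by rewrite lee_fin tree_max_ge0.
have mts := @measurable_tree_sup _ _ u q r r0.
have H := @maximal_mean_osc_le _ _ u u0 ui mu (fun=> K) (fun=> ltW K0)
  (fun _ _ _ _ => lexx K) oscK z m mu_m q r r0 qz g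
  ((2 * 6 ^+ n + 4 + 2 ^+ n) * K) _ _ _ _ k Mi.
apply: le_trans (H _ _ _ _) _ => {H}.
- by apply: emeasurable_funD; [exact: measurable_cst|exact: mts].
- by move=> x; rewrite /g adde_ge0.
- rewrite /g ge0_integralD; [|exact: mh|by []|exact: measurable_cst|by []|exact: mts].
  rewrite (integral_cst leb mh (2 * 6 ^+ n * K)%:E) [X in (_ * X + _)%E](lebesgue_hcube q r0).
  have h := integral_tree_sup ui K0 bmo q r0.
  apply: (@le_trans _ _ ((2 * 6 ^+ n * K * (2 * r) ^+ n)%:E +
      ((4 + 2 ^+ n) * K * (2 * r) ^+ n)%:E)%E).
    by rewrite -EFinM; apply: leeD2l.
  rewrite -EFinD lee_fin le_eqVlt; apply/orP; left; apply/eqP; ring.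
- move=> x j qx; have [p [px pm]] := tree_max_cube u (cube_mean u q r) j r0 qx.
  exists p; split => //; rewrite addrC EFinD; apply: leeD.
    set t := r / _; have t0 : 0 < t by rewrite divr_gt0// exprn_gt0.
    have t3 : 0 < 3 * t by rewrite mulr_gt0.
    rewrite lee_fin -mulrA ler_pM2l// ler_pdivrMr ?exprn_gt0//.
    apply: le_trans (bmo _ _ t3) _.
    rewrite (_ : 2 * (3 * t) = 6 * t); last by ring.
    by rewrite exprMn le_eqVlt; apply/orP; left; apply/eqP; ring.
  by apply: le_trans (tree_sup_ge u j q r x); rewrite lee_fin.
rewrite /translation_error lee_fin.
rewrite -[leRHS]mulrA ler_pM2l//.
have Km : K <= K * m by rewrite ler_peMr// ltW.
have k0 : 0 <= 2 * 6 ^+ n + 4 + 2 ^+ n :> R by rewrite !addr_ge0 ?mulr_ge0 ?exprn_ge0.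
have := ler_wpM2l k0 Km; lra.
Qed.

End bounded_mean_oscillation.

(** * Diameter against radius of a cube *)

Section diameters.
Context {R : realType} {n : nat}.
Local Notation V := 'rV[R]_n.
Implicit Types (p x y : V) (r : R).

Lemma edist_cube p r x y : 0 < r -> cube p r x -> cube p r y ->
  Defs.edist x y <= 2 * r * Num.sqrt n%:R.
Proof.
move=> r0 px py; rewrite /Defs.edist -[2 * r]ger0_norm; last by lra.
rewrite -sqrtr_sqr -sqrtrM ?sqr_ge0// ler_wsqrtr//.
rewrite (_ : _ * n%:R = \sum_(i < n) (2 * r) ^+ 2); last first.
  by rewrite sumr_const card_ord -[RHS]mulr_natr.
apply: ler_sum => i _; rewrite -real_normK ?num_real// lerXn2r ?nnegrE//; first by lra.
by have := px i; have := py i; rewrite ler_norml; lra.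
Qed.

Lemma diam_cube_le p r : 0 < r -> diam (cube p r) <= 2 * r * Num.sqrt n%:R.
Proof.
move=> r0; apply: ge_sup => [|_ [x px [y py <-]]]; last exact: edist_cube px py.
have pp : cube p r p by move=> i; lra.
by exists (Defs.edist p p), p => //; exists p.
Qed.

Lemma diam_cube_ge p r : (0 < n)%N -> 0 < r -> r <= diam (cube p r).
Proof.
move=> n0 r0; pose x : V := \row_i (p ord0 i - r / 2).
pose y : V := \row_i (p ord0 i + r / 2).
apply: (@le_trans _ _ (Defs.edist x y)); last first.
  apply: ub_le_sup.
    exists (2 * r * Num.sqrt n%:R) => _ [a pa [b pb <-]]; exact: edist_cube pa pb.
  exists x; first by move=> i; rewrite mxE; lra.
  by exists y => //; move=> i; rewrite mxE; lra.
rewrite /Defs.edist -[leLHS]ger0_norm ?(ltW r0)// -sqrtr_sqr ler_wsqrtr//.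
rewrite (bigD1 (Ordinal n0))//= !mxE.
rewrite (_ : _ - _ = - r); last by lra.
by rewrite sqrrN lerDl sumr_ge0// => i _; exact: sqr_ge0.
Qed.

End diameters.

Lemma mean_osc_cube (R : realType) n (u : 'rV[R]_n -> R) p t :
  (forall x, 0 <= u x) ->
  (forall p r, (@lebesgueRn R n).-integrable (hcube p r) (EFin \o u)) ->
  0 < t ->
  mean_osc (EFin \o u) (cube p t) = (osc u p t / (2 * t) ^+ n)%:E.
Proof.
move=> u0 ui t0; have mE : avg (EFin \o u) (cube p t) = (cube_mean u p t)%:E.
  rewrite -(avg_cube_mean u0 ui p t0); congr avg.
  by apply/funext => y /=; rewrite ger0_norm.
have /integrableP[mf _] := integrable_absdev ui (cube_mean u p t) p t0.
by rewrite /mean_osc mE avg_cube// (EFin_absdev ui _ _ t0) -EFinM mulrC.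
Qed.

(** The cube centred at [x] is admissible for both kinds, so the kind used for [mu] may differ from
    the one used for [u]. *)
Lemma maximal_measure_density (R : realType) n k (mu : {measure set (borelRn R n) -> \bar R})
    (x : 'rV[R]_n) s : 0 < s ->
  (mu (cube x s) <= maximal_measure k mu x * ((2 * s) ^+ n)%:E)%E.
Proof.
move=> s0; have v0 := vol_gt0 (n := n) s0.
rewrite -lee_pdivrMr//; apply: ereal_sup_ubound; exists (cube x s).
  case: k => /=; first by exists s.
  by split; [exists x, s|move=> i; lra].
by rewrite [X in (_ * X^-1)%E](lebesgue_cube x s0) inver gt_eqF.
Qed.

(** Joins the two alternatives; [K] is fixed before [u], [mu] and the cube, so it depends only on
    [n] and [alpha]. *)
Lemma maximal_osc_powR (R : realType) (n : nat) (alpha : R) : 0 <= alpha ->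
  exists K : R, 0 < K /\
  forall (k : maximal_kind) (u : 'rV[R]_n -> R)
    (mu : {measure set (borelRn R n) -> \bar R}) (C1 : R) z m q r,
  (forall x, 0 <= u x) ->
  (forall p r, (@lebesgueRn R n).-integrable (hcube p r) (EFin \o u)) ->
  loc_integrable (maximal k (EFin \o u)) ->
  (alpha = 0 -> forall p t, 0 < t -> mu (cube p t) = ((2 * t) ^+ n)%:E) ->
  0 < C1 ->
  (forall p t, 0 < t -> ((osc u p t)%:E <= (C1 * t `^ alpha)%:E * mu (cube p t))%E) ->
  (forall s, 0 < s -> (mu (cube z s) <= (m * (2 * s) ^+ n)%:E)%E) ->
  0 < r -> cube q r z ->
  (mean_osc (maximal k (EFin \o u)) (cube q r) <= (K * (C1 * r `^ alpha * m))%:E)%E.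
Proof.
rewrite le_eqVlt => /predU1P[<-|a0].
  exists (2 * (2 * 24 ^+ n + 2 * 6 ^+ n + 4 + 2 ^+ n)); split.
    by rewrite mulr_gt0// !addr_gt0 ?mulr_gt0 ?exprn_gt0.
  move=> k u mu C1 z m q r u0 ui Mi mul C10 oscC mu_m r0 qz.
  rewrite powRr0 mulr1; apply: maximal_mean_osc_bmo mu_m r0 qz Mi => //.
    exact: mul.
  by move=> p t t0; have := oscC p t t0; rewrite powRr0 mulr1.
exists (2 * (2 * 24 ^+ n * 6 `^ alpha + 2 * 32 ^+ n * 3 `^ alpha / (1 - 2^-1 `^ alpha))).
split.
  have h : 2^-1 `^ alpha < 1 :> R.
    rewrite -[ltRHS]/((fun=> 1) alpha) -powR1.
    by apply: gt0_ltr_powR => //; rewrite ?nnegrE ?invr_ge0//; lra.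
  rewrite mulr_gt0// addr_gt0 ?divr_gt0 ?mulr_gt0 ?exprn_gt0 ?powR_gt0//.
  by rewrite subr_gt0.
move=> k u mu C1 z m q r u0 ui Mi _ C10 oscC mu_m r0 qz.
exact: (maximal_mean_osc_powR u0 ui C10 (ltW a0) oscC mu_m r0 qz Mi).
Qed.

Local Open Scope ereal_scope.

Theorem theorem3p1 (R : realType) (n : nat) (alpha : R) :
  (1 < n)%N ->
  exists c : R, (0 < c)%R /\
  forall (k k' : maximal_kind) (u : 'rV[R]_n -> R)
    (mu : {measure set (borelRn R n) -> \bar R}) (C : R),
  (forall x, (0 <= u x)%R) ->
  loc_integrable (EFin \o u) ->
  loc_integrable (maximal k (EFin \o u)) ->
  (alpha = 0%R /\
     (forall A : set (borelRn R n), measurable A -> mu A = lebesgueRn A)) \/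
  ((0 < alpha <= 1)%R /\ borel_loc_finite mu) ->
  (0 < C)%R ->
  (forall Q : set 'rV[R]_n, is_cube Q ->
     mean_osc (EFin \o u) Q <=
     C%:E * (diam Q `^ alpha)%:E * (mu Q * (lebesgueRn Q)^-1)) ->
  exists C' : R, [/\ (0 < C')%R, (C' <= c * C)%R &
    forall Q : set 'rV[R]_n, is_cube Q ->
      mean_osc (maximal k (EFin \o u)) Q <=
      C'%:E * (diam Q `^ alpha)%:E *
        ereal_inf [set maximal_measure k' mu z | z in Q]].
Proof.
move=> n1; have n0 : (0 < n)%N by exact: ltnW.
have [a0|aneg] := leP 0%R alpha; last first.
  (* Both alternatives exclude a negative [alpha], so any constant will do. *)
  exists 1%R; split => // k k' u mu C _ _ _ [[a0 _]|[/andP[a0 _] _]] _ _.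
    by move: aneg; rewrite a0 ltxx.
  by move: aneg; rewrite ltNge (ltW a0).
have [K [K0 HK]] := @maximal_osc_powR R n alpha a0.
(* The diameter is at most [2 * Num.sqrt n%:R] times the radius, so [L] is the cost of passing from
   diameters to radii in the hypothesis. *)
pose L : R := ((2 * Num.sqrt n%:R) `^ alpha)%R.
have sn0 : (0 < 2 * Num.sqrt n%:R :> R)%R by rewrite mulr_gt0// sqrtr_gt0 ltr0n.
have L0 : (0 < L)%R by exact: powR_gt0.
exists (K * L)%R; split; first exact: mulr_gt0.
move=> k k' u mu C u0 ul Mi Hmu C0 HC.
have ui p t : (@lebesgueRn R n).-integrable (hcube p t) (EFin \o u).
  exact: loc_integrable_hcube.
exists (K * L * C)%R; split => //; first by rewrite !mulr_gt0.
move=> _ [q [r [r0 ->]]].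
have dr0 : (0 < diam (cube q r) `^ alpha)%R.
  by apply: powR_gt0; apply: lt_le_trans (diam_cube_ge q n0 r0).
set F : R := (K * L * C * diam (cube q r) `^ alpha)%R.
have F0 : (0 < F)%R by rewrite !mulr_gt0.
(* Dividing by [F] turns the bound by the infimum into one bound for each point [z] of the cube. *)
rewrite -EFinM -/F muleC -lee_pdivrMr//.
apply: le_ereal_inf_tmp => _ [z qz <-]; rewrite lee_pdivrMr//.
have CL0 : (0 < C * L)%R by exact: mulr_gt0.
have dens s : (0 < s)%R ->
    mu (cube z s) <= maximal_measure k' mu z * ((2 * s) ^+ n)%:E.
  exact: maximal_measure_density.
case ME : (maximal_measure k' mu z) => [m| |].
- have mu_m s : (0 < s)%R -> mu (cube z s) <= (m * (2 * s) ^+ n)%:E.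
    by move=> s0; rewrite EFinM -ME; exact: dens.
  have m0 : (0 <= m)%R by exact: density_ge0 mu_m.
  apply: le_trans (HK k u mu (C * L)%R z m q r u0 ui Mi _ CL0 _ mu_m r0 qz) _.
  + move=> a00 p t t0; case: Hmu => [[_ ->]|[/andP[]]]; last by rewrite a00 ltxx.
      exact: lebesgue_cube.
    exact: borel_cube.
  (* The volume cancels from both sides of the hypothesis, leaving the unnormalised [osc] and
     [mu]. *)
  + move=> p t t0; have v0 := vol_gt0 (n := n) t0.
    have Qt : is_cube (cube p t) by exists p, t.
    have := HC _ Qt; rewrite mean_osc_cube// EFinM lee_pdivrMr//.
    rewrite [X in (_ * (_ * X^-1) * _)](lebesgue_cube p t0) inver gt_eqF//.
    rewrite -!muleA -EFinM mulVf ?gt_eqF// mule1 muleA -EFinM.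
    move=> /le_trans; apply; apply: lee_wpmul2r; first exact: measure_ge0.
    rewrite lee_fin -mulrA ler_pM2l// /L -powRM ?(ltW t0) ?(ltW sn0)//.
    apply: ge0_ler_powR => //; rewrite ?nnegrE.
    * by apply: le_trans (diam_cube_ge p n0 t0); exact: ltW.
    * by rewrite mulr_ge0 ?ltW.
    * by rewrite mulrAC; exact: diam_cube_le.
  (* Back from the radius to the diameter, which is at least [r]. *)
  + rewrite -EFinM lee_fin /F.
    rewrite (_ : K * _ = K * L * C * m * r `^ alpha)%R; last by ring.
    rewrite (_ : m * _ = K * L * C * m * diam (cube q r) `^ alpha)%R; last by ring.
    apply: ler_wpM2l; first by rewrite !mulr_ge0// ltW.
    apply: ge0_ler_powR => //; rewrite ?nnegrE; [exact: ltW| |exact: diam_cube_ge].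
    by apply: le_trans (diam_cube_ge q n0 r0); exact: ltW.
- by rewrite gt0_mulye ?lte_fin// leey.
- have := dens 1%R ltr01; rewrite ME gt0_mulNye ?lte_fin ?vol_gt0//.
  by move=> /(le_trans (measure_ge0 mu (cube z 1))).
Qed.
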